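(* Let $T>0$ and let $\Phi:\mathbb{R}^d\to[0,+\infty)$ be a strictly convex $N_\infty$ function. Let $F:[0,T]\times\mathbb{R}^d\to\mathbb{R}$ be differentiable with respect to $x$ for a.e. $t\in[0,T]$ and satisfy: (i) $F$ and $\nabla_xF$ are Carathéodory functions, i.e. measurable in $t\in[0,T]$ for every $x\in\mathbb{R}^d$ and continuous in $x\in\mathbb{R}^d$ for a.e. $t\in[0,T]$; (ii) there exist $a\in C(\mathbb{R}^d,[0,+\infty))$ and $0\le b\in L^1([0,T],\mathbb{R})$ such that $|F(t,x)|+|\nabla_xF(t,x)|\le a(x)b(t)$ for a.e. $t\in[0,T]$ and every $x\in\mathbb{R}^d$; (iii) there exist an $N_\infty$ function $\Phi_0:\mathbb{R}^d\to[0,+\infty)$ such that for every $k>0$ there is $C(k)>0$ with $\Phi_0(x)\le C(k)+\Phi(kx)$ for all $x\in\mathbb{R}^d$, and a function $\delta\in L^1([0,T],\mathbb{R})$ with $\delta\ge 1$, such that $\Phi^\star\!\left(\nabla_xF(t,x)/\delta(t)\right)\le \Phi_0(x)+1$ for a.e. $t\in[0,T]$ and every $x\in\mathbb{R}^d$; (iv) with the same $\Phi_0$ as in (iii), $\displaystyle\lim_{|x|\to\infty}\frac{\int_0^TF(t,x)\,dt}{\Phi_0(2x)}=+\infty$. Let $I(u)=\int_0^T\Phi(u'(t))+F(t,u(t))\,dt$. If $u$ is a minimum of $I$ on the set $$H=\{u\in W^1L^\Phi([0,T],\mathbb{R}^d): u(0)=u(T)\}$$ and $d\big(u',L^\infty([0,T],\mathbb{R}^d)\big)<1$,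 then $u$ is a solution of $$\frac{d}{dt}\nabla\Phi(u'(t))=\nabla_xF(t,u(t))\ \text{ for a.e. }t\in(0,T),\qquad u(0)-u(T)=u'(0)-u'(T)=0.$$
   Context: $|\cdot|$ is the Euclidean norm on $\mathbb{R}^d$. An $N_\infty$ function is a differentiable convex function $\Phi:\mathbb{R}^d\to[0,+\infty)$ with $\Phi(0)=0$, $\Phi(y)>0$ for $y\ne0$, $\Phi(-y)=\Phi(y)$, and $\lim_{|y|\to\infty}\Phi(y)/|y|=+\infty$. Its complementary function is $\Phi^\star(\zeta)=\sup_{y\in\mathbb{R}^d}\,(y\cdot\zeta-\Phi(y))$. $L^\Phi=L^\Phi([0,T],\mathbb{R}^d)$ is the set of measurable $u:[0,T]\to\mathbb{R}^d$ such that $\int_0^T\Phi(\lambda u)\,dt<\infty$ for some $\lambda>0$, with the Luxemburg norm $\|u\|_{L^\Phi}=\inf\{\lambda>0:\int_0^T\Phi(u/\lambda)\,dt\le1\}$. For $u\in L^\Phi$ and $X\subset L^\Phi$, $d(u,X)$ is the distance from $u$ to $X$ in the Luxemburg norm. $W^1L^\Phi([0,T],\mathbb{R}^d)$ is the set of absolutely continuous $u:[0,T]\to\mathbb{R}^d$ with $u'\in L^\Phi$, normed by $\|u\|_{W^1L^\Phi}=\|u\|_{L^\Phi}+\|u'\|_{L^\Phi}$. The functional $I$ takes values in $(-\infty,+\infty]$; ''$u$ is a minimum of $I$ on $H$'' means $u\in H$ and $I(u)\le I(v)$ for all $v\in H$. A solution is understood as follows: $\nabla\Phi(u')$ coincides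 a.e. with an absolutely continuous function on $[0,T]$ whose derivative equals $\nabla_xF(t,u(t))$ a.e., and the values $u'(0),u'(T)$ are those of the corresponding continuous representative of $u'$. *)

(* Defs.v *)
From HB Require Import structures.
From mathcomp Require Import all_boot all_order all_algebra.
From mathcomp Require Import all_classical all_reals all_analysis.

Set Implicit Arguments.
Unset Strict Implicit.
Unset Printing Implicit Defensive.

Import Order.TTheory GRing.Theory Num.Theory.
Import numFieldNormedType.Exports.

Local Open Scope classical_set_scope.
Local Open Scope ring_scope.

(* The Lebesgue measure on the Lebesgue (not merely Borel) sigma-algebra of R:
   null sets, measurability, integrability and integrals all refer to it.  Its
   carrier is convertible to R. *)
Notation leb R := (@completed_lebesgue_measure R).
Notation lebType R :=
  (caratheodory_type (@wlength R idfun)^*%mu) (only parsing).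

Section EuclideanSpace.
Context {R : realType} {d : nat}.
Implicit Types (x y : 'rV[R]_d) (f : 'rV[R]_d -> R).

Definition dotmul x y : R := \sum_(i < d) x ord0 i * y ord0 i.

(* The library norm `|x| on 'rV[R]_d is the sup norm; the two norms induce the
   same topology and the same notion of differentiability. *)
Definition enorm x : R := Num.sqrt (dotmul x x).

Definition enorm_pinfty : set_system 'rV[R]_d :=
  [set A | exists M : R, forall x, M < enorm x -> A x].

Definition grad f x : 'rV[R]_d := \row_(i < d) 'D_(delta_mx ord0 i) f x.

Definition strictly_convex f : Prop :=
  forall x y (t : R), x != y -> 0 < t < 1 ->
    f (t *: x + (1 - t) *: y) < t * f x + (1 - t) * f y.

Record Ninfty_function (Phi : 'rV[R]_d -> R) : Prop := {
  Ninfty_differentiable : forall y, differentiable Phi y ;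
  Ninfty_convex : convex_function [set: convex_lmodType 'rV[R]_d] Phi ;
  Ninfty_ge0 : forall y, 0 <= Phi y ;
  Ninfty_at0 : Phi 0 = 0 ;
  Ninfty_gt0 : forall y, y != 0 -> 0 < Phi y ;
  Ninfty_even : forall y, Phi (- y) = Phi y ;
  Ninfty_superlinear : Phi y / enorm y @[y --> enorm_pinfty] --> +oo_R }.

Definition complementary (Phi : 'rV[R]_d -> R) (zeta : 'rV[R]_d) : \bar R :=
  ereal_sup [set (dotmul y zeta - Phi y)%:E | y in [set: 'rV[R]_d]].

End EuclideanSpace.

(* Functions on [0, T] are represented by functions on R, only the restriction
   of which to `[0, T] matters. *)
Section OrliczSobolev.
Context {R : realType} {d : nat}.
Variables (T : R) (Phi : 'rV[R]_d -> R).
Implicit Types (u v : R -> 'rV[R]_d) (X : set (R -> 'rV[R]_d)).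

Definition vmeasurable u : Prop :=
  forall i : 'I_d,
    measurable_fun (`[0, T] : set (lebType R)) (fun t => u t ord0 i).

Definition L_Phi : set (R -> 'rV[R]_d) :=
  [set u | vmeasurable u /\
    exists2 lambda : R, 0 < lambda &
      (\int[leb R]_(t in `[0%R, T]) (Phi (lambda *: u t))%:E < +oo)%E].

Definition luxemburg_norm u : \bar R :=
  ereal_inf [set lambda%:E | lambda in [set lambda : R | 0 < lambda /\
    (\int[leb R]_(t in `[0%R, T]) (Phi (lambda^-1 *: u t))%:E <= 1)%E]].

Definition luxemburg_dist u X : \bar R :=
  ereal_inf [set luxemburg_norm (fun t => u t - v t) | v in X].

Definition L_infty : set (R -> 'rV[R]_d) :=
  [set u | vmeasurable u /\
    exists M : R, {ae leb R, forall t, t \in `[0, T] -> enorm (u t) <= M}].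

Definition absolutely_continuous u : Prop :=
  forall eps : R, 0 < eps -> exists2 delta : R, 0 < delta &
    forall (n : nat) (a b : 'I_n -> R),
      (forall i, [/\ 0 <= a i, a i <= b i & b i <= T]) ->
      (forall i j, i != j -> b i <= a j \/ b j <= a i) ->
      \sum_(i < n) (b i - a i) < delta ->
      \sum_(i < n) enorm (u (b i) - u (a i)) < eps.

(* derive1 u is total, with junk values where u is not derivable, so we record
   that u' exists a.e., which every absolutely continuous u satisfies. *)
Definition W1L_Phi : set (R -> 'rV[R]_d) :=
  [set u | [/\ absolutely_continuous u,
    {ae leb R, forall t, t \in `]0, T[ -> derivable u t 1} &
    L_Phi (derive1 u)]].

End OrliczSobolev.

Section EulerLagrange.
Context {R : realType} {d : nat}.
Variables (T : R) (Phi : 'rV[R]_d -> R) (F : R -> 'rV[R]_d -> R).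
Implicit Type u : R -> 'rV[R]_d.

Definition caratheodory (f : R -> 'rV[R]_d -> R) : Prop :=
  (forall x, measurable_fun (`[0, T] : set (lebType R)) (f ^~ x)) /\
  {ae leb R, forall t, t \in `[0, T] -> continuous (f t)}.

Definition vcaratheodory (f : R -> 'rV[R]_d -> 'rV[R]_d) : Prop :=
  (forall x, vmeasurable T (f ^~ x)) /\
  {ae leb R, forall t, t \in `[0, T] -> continuous (f t)}.

Definition action u : \bar R :=
  \int[leb R]_(t in `[0%R, T]) (Phi (derive1 u t) + F t (u t))%:E.

Definition periodic_W1L_Phi : set (R -> 'rV[R]_d) :=
  [set u | W1L_Phi T Phi u /\ u 0 = u T].

Definition is_minimum_on (H : set (R -> 'rV[R]_d)) u : Prop :=
  H u /\ forall v, H v -> (action u <= action v)%E.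

(* p is the absolutely continuous representative of grad Phi (u'), and w the
   corresponding continuous representative of u'. *)
Definition periodic_solution u : Prop :=
  exists p w : R -> 'rV[R]_d,
  [/\ absolutely_continuous T p,
      {ae leb R, forall t, t \in `[0, T] -> grad Phi (derive1 u t) = p t},
      {ae leb R, forall t, t \in `]0, T[ -> is_derive t 1 p (grad (F t) (u t))}
    & [/\ {within `[0, T], continuous w},
          {ae leb R, forall t, t \in `[0, T] -> derive1 u t = w t},
          forall t, t \in `[0, T] -> grad Phi (w t) = p t,
          u 0 - u T = 0
        & w 0 - w T = 0]].

End EulerLagrange.

(* Main.v *)
Require Import Defs.
From HB Require Import structures.
From mathcomp Require Import all_boot all_order all_algebra.
From mathcomp Require Import all_classical all_reals all_analysis.
From mathcomp Require Import measurable_realfun ring lra.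
Import Order.TTheory GRing.Theory Num.Theory.
Import numFieldNormedType.Exports.
Local Open Scope classical_set_scope.
Local Open Scope ring_scope.

Set Implicit Arguments.
Unset Strict Implicit.
Unset Printing Implicit Defensive.

(* Since d(u', L^infty) < 1, write u' + k for bounded k as a convex combination
   of (u' - v) / l and (v + k) / (1 - l) with v bounded and l < 1: thus
   Phi (u' + k) is integrable for every bounded k, without any Delta_2
   condition.  Hence I is finite along u + s eta e_i for every Lipschitz eta
   with eta 0 = eta T, the monotone difference quotients of the convex Phi (and
   the mean value theorem for F) allow dominated convergence, and
   int (d_i Phi (u') eta' + d_i F (t, u) eta) = 0.  Taking for eta a constant,
   then the difference of two steep ramps, Lebesgue differentiation gives
   int_0^T d_i F (t, u) = 0 and d_i Phi (u') = c_i + int_0^t d_i F (s, u) a.e.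
   Finally, a strictly convex superlinear differentiable Phi has a gradient with
   a continuous inverse, z |-> argmin (Phi - <., z>), which yields the continuous
   representative of u' and its periodicity. *)

(** * The completed Lebesgue measure *)

(** A distance below 1 controls [Phi] at [u'] plus a bounded function but not, say, at [2 u']; so
    only bounded changes of [u'] are sure to keep the action finite, and this is why the tests are
    Lipschitz. The dominating function must come from the same source: the convex quotients at steps
    in [0, 1] lie between two increments of [Phi] at steps -1 and 1. Minimality is exploited at s =
    1/(n+1) only and gives an inequality, which the test - eta reverses. A single ramp climbs from 0
    to 1 and violates periodicity; a difference of two is periodic and compares d_i Phi (u') at two
    points. The constant test gives p(0) = p(T), and the inverse gradient transports this to w. A
    second obstacle is measure-theoretic: integrals refer to Lebesgue sets, the differentiation
    theorem to Borel ones, so integrands are exchanged for Borel functions equal to them a.e.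
    Conversely, derivatives are identified only a.e., and it is completeness of the measure that
    keeps them measurable. *)

Section lebesgue_completion.
Context {R : realType}.
Notation lambda := (@lebesgue_measure R).

Lemma borel_leb_measurable (A : set R) :
  @measurable _ (measurableTypeR R) A -> @measurable _ (lebType R) A.
Proof. exact: sub_caratheodory. Qed.

Lemma leb_measurable_itv (i : interval R) :
  @measurable _ (lebType R) ([set` i] : set R).
Proof. by apply: borel_leb_measurable; exact: measurable_itv. Qed.

Lemma measurable_id_leb :
  measurable_fun setT (id : lebType R -> measurableTypeR R).
Proof. by move=> _ A mA; rewrite setTI; exact: borel_leb_measurable. Qed.

Lemma lebesgue_ae_leb (P : R -> Prop) :
  {ae lambda, forall x, P x} -> {ae leb R, forall x, P x}.
Proof.
by move=> [N [mN N0 PN]]; exists N; split => //; exact: borel_leb_measurable.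
Qed.

(** The Carathéodory sigma-algebra is the completion of the Borel one, so [A] is a Borel set
    together with a subset of a Borel null set [N]; removing [N] discards the uncontrolled part. *)
Lemma leb_measurable_decomp (A : set R) : @measurable _ (lebType R) A ->
  exists B N : set R, [/\ @measurable _ (measurableTypeR R) B,
    @measurable _ (measurableTypeR R) N, lambda N = 0%E &
    A `\` N = B `\` N].
Proof.
move=> mA.
have : completed_algebra_gen lambda A.
  rewrite -g_sigma_completed_algebra_genE.
  by rewrite completed_caratheodory_measurable.
move=> [B mB [M [N [mN N0 MN]]] <-{A mA}].
exists B, N; split => //; apply/seteqP; split => x /= [].
  by case=> // /MN.
by move=> ? ?; split => //; left.
Qed.

(** A real function is determined by its superlevel sets at rational levels. Each is Borel off a
    null set, and the countable union [M] of these null sets is still null. *)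
Lemma leb_measurable_borel_version (f : R -> R) :
  measurable_fun (setT : set (lebType R)) f ->
  exists2 g : R -> R, measurable_fun (setT : set (measurableTypeR R)) g &
    {ae lambda, forall x, f x = g x}.
Proof.
move=> mf.
have dec (q : rat) : exists BN : set R * set R,
    [/\ @measurable _ (measurableTypeR R) BN.1,
    @measurable _ (measurableTypeR R) BN.2, lambda BN.2 = 0%E &
    (f @^-1` `]ratr q, +oo[) `\` BN.2 = BN.1 `\` BN.2].
  have [B [N BN]] := @leb_measurable_decomp (f @^-1` `]ratr q, +oo[)
    (ltac:(by rewrite -[X in measurable X]setTI; exact: mf)).
  by exists (B, N).
pose B q := (projT1 (cid (dec q))).1.
pose N q := (projT1 (cid (dec q))).2.
have BN q : [/\ @measurable _ (measurableTypeR R) (B q),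
    @measurable _ (measurableTypeR R) (N q), lambda (N q) = 0%E &
    (f @^-1` `]ratr q, +oo[) `\` N q = B q `\` N q].
  by rewrite /B /N; case: cid.
pose M : set R := \bigcup_q N q.
have mM : @measurable _ (measurableTypeR R) M.
  by apply: bigcupT_measurable_rat => q; case: (BN q).
exists (f \_ (~` M)); last first.
  have : lambda.-negligible M.
    have -> : M = \bigcup_n (if unpickle n is Some q then N q else set0).
      apply/seteqP; split => x [].
        by move=> q _ Nx; exists (pickle q); [exact: I|rewrite pickleK; exact: Nx].
      by move=> n _; case: unpickle => // q Nx; exists q.
    apply: negligible_bigcup => n; case: unpickle => [q|].
      by case: (BN q) => _ mN N0 _; exists (N q); split.
    exact: negligible_set0.
  apply: negligibleS => x /= /eqP; rewrite patchE.
  by case: ifPn => [_ /eqP//|]; rewrite notin_setE /= notK.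
apply: (measurability _ (RGenOInfty.measurableE R)) => // _ [_ [r ->] <-].
rewrite setTI.
(* On [M] the patched function has the default value 0, which exceeds r exactly when some rational q
   satisfies r < q < 0; hence the second member of each union. *)
have -> : f \_ (~` M) @^-1` `]r, +oo[ = \bigcup_(q in [set q | r < ratr q])
   ((B q `\` M) `|` (M `&` [set _ | ratr q < 0 :> R])).
  apply/seteqP; split => x /=; rewrite in_itv/= andbT patchE.
    case: ifPn => [|].
      rewrite inE /= => Mx rfx.
      have /rat_in_itvoo[q] := rfx; rewrite in_itv/= => /andP[rq qf].
      exists q => //; left; split => //.
      have [_ _ _ fB] := BN q.
      have : (f @^-1` `]ratr q, +oo[ `\` N q) x.
        split; first by rewrite /= in_itv/= qf.
        by move=> Nx; apply: Mx; exists q.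
      by rewrite fB => -[].
    rewrite notin_setE /= notK => Mx /rat_in_itvoo[q].
    by rewrite in_itv/= => /andP[rq q0]; exists q => //; right.
  move=> [q /= rq [[Bx Mx]|[Mx q0]]].
    rewrite mem_set//.
    have [_ _ _ fB] := BN q.
    have : (B q `\` N q) x by split => // Nx; apply: Mx; exists q.
    by rewrite -fB => -[/=]; rewrite in_itv/= andbT => /(lt_trans rq).
  by rewrite memNset//=; exact: lt_trans q0.
rewrite bigcup_mkcond; apply: bigcupT_measurable_rat => q.
case: ifPn => // _; apply: measurableU.
  by apply: measurableD => //; case: (BN q).
apply: measurableI => //.
have [q0|q0] := pselect (ratr q < 0 :> R).
  by rewrite (_ : [set _ | _] = setT)//; apply/seteqP; split.
by rewrite (_ : [set _ | _] = set0)//; apply/seteqP; split.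
Qed.

(* The set functions [pushforward (leb R) id] and [lambda] are convertible. *)
Lemma borel_leb_integrable (D : set R) (g : R -> \bar R) :
  @measurable _ (measurableTypeR R) D ->
  measurable_fun (setT : set (measurableTypeR R)) g ->
  (leb R).-integrable D g -> lambda.-integrable D g.
Proof.
move=> mD mg ig.
exact: (@integrable_pushforward _ _ (lebType R)
  (measurableTypeR R) R id measurable_id_leb (leb R) D g mg ig mD).
Qed.

Lemma borel_leb_integral (D : set R) (g : R -> \bar R) :
  @measurable _ (measurableTypeR R) D ->
  measurable_fun (setT : set (measurableTypeR R)) g ->
  (leb R).-integrable D g ->
  (\int[leb R]_(x in D) g x = \int[lambda]_(x in D) g x)%E.
Proof.
move=> mD mg ig; apply: esym.
exact: (@integral_pushforward _ _ (lebType R)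
  (measurableTypeR R) R id measurable_id_leb (leb R) D g mg ig mD).
Qed.

End lebesgue_completion.

(** * Almost-everywhere arguments and differentiation of integrals for the completed measure *)

Section leb_complete.
Context {R : realType}.
Implicit Types (D : set (lebType R)) (f g : R -> R).

Lemma leb_aeS (P Q : R -> Prop) : (forall x, P x -> Q x) ->
  {ae leb R, forall x, P x} -> {ae leb R, forall x, Q x}.
Proof. exact: (@filterS _ _ (ae_filter_ringOfSetsType (leb R))). Qed.

Lemma leb_aeS2 (P P' Q : R -> Prop) : (forall x, P x -> P' x -> Q x) ->
  {ae leb R, forall x, P x} -> {ae leb R, forall x, P' x} ->
  {ae leb R, forall x, Q x}.
Proof. exact: (@filterS2 _ _ (ae_filter_ringOfSetsType (leb R))). Qed.

Lemma leb_aeS3 (P P' P'' Q : R -> Prop) :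
  (forall x, P x -> P' x -> P'' x -> Q x) ->
  {ae leb R, forall x, P x} -> {ae leb R, forall x, P' x} ->
  {ae leb R, forall x, P'' x} -> {ae leb R, forall x, Q x}.
Proof. exact: (@filterS3 _ _ (ae_filter_ringOfSetsType (leb R))). Qed.

(** This is where completeness of the measure enters: changing a function on a null set keeps it
    measurable. *)
Lemma leb_ae_measurable D f g :
  {ae leb R, forall t, D t -> f t = g t} ->
  measurable_fun D f -> measurable_fun D g.
Proof.
move=> fg /measurable_EFinP mf; apply/measurable_EFinP.
apply: (ae_measurable_fun (@completed_lebesgue_measure_is_complete R) _ mf).
by apply: leb_aeS fg => t + Dt => /(_ Dt) /= ->.
Qed.

Lemma leb_ae_integrable D f g : measurable D ->
  {ae leb R, forall t, D t -> f t = g t} ->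
  (leb R).-integrable D (EFin \o f) -> (leb R).-integrable D (EFin \o g).
Proof.
move=> mD fg /integrableP[/measurable_EFinP mf foo].
have mg := leb_ae_measurable fg mf.
apply/integrableP; split; first exact/measurable_EFinP.
have mabs (h : R -> R) : measurable_fun D h ->
    measurable_fun D (fun x => `|(EFin \o h) x|%E).
  move=> mh; apply: measurableT_comp; first exact: abse_measurable.
  exact/measurable_EFinP.
have <- : (\int[leb R]_(x in D) `|(EFin \o f) x| =
    \int[leb R]_(x in D) `|(EFin \o g) x|)%E.
  apply: ae_eq_integral; [exact: mD|exact: mabs|exact: mabs|].
  by apply: leb_aeS fg => t + Dt => /(_ Dt) /= ->.
exact: foo.
Qed.

(** The upper limit of the sequence is defined and measurable everywhere, and agrees with [f] a.e.;
    completeness does the rest. *)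
Lemma leb_ae_cvg_measurable D (f_ : (R -> R)^nat) f :
  (forall n, measurable_fun D (f_ n)) ->
  {ae leb R, forall t, D t -> f_ n t @[n --> \oo] --> f t} ->
  measurable_fun D f.
Proof.
move=> mf_ ff; apply/measurable_EFinP.
have mlim : measurable_fun D (fun x => limn_esup (fun n => (f_ n x)%:E)).
  by apply: measurable_fun_limn_esup => n; exact/measurable_EFinP.
apply: (ae_measurable_fun (@completed_lebesgue_measure_is_complete R) _ mlim).
apply: leb_aeS ff => t + Dt => /(_ Dt) cf.
have cE : (f_ n t)%:E @[n --> \oo] --> (f t)%:E.
  by apply: cvg_EFin => //; exact: nearW.
by rewrite (cvg_limn_einf_sup cE).
Qed.

(** Extend [f] by 0 outside [0, T], pass to a Borel version [g], and apply Lebesgue differentiation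
    to [g]. *)
Lemma leb_FTC1 (T : R) f :
  (leb R).-integrable `[0, T] (EFin \o f) ->
  {ae leb R, forall t, t \in `]0, T[ ->
    is_derive t 1 (fun x => \int[leb R]_(s in `[0, x]) f s) (f t)}.
Proof.
move=> intf.
have mI (i : interval R) : @measurable _ (lebType R) ([set` i] : set R).
  exact: leb_measurable_itv.
pose fT := f \_ `[0, T].
have intfT : (leb R).-integrable setT (EFin \o fT).
  by move/(integrable_mkcond _ (mI _)): intf; rewrite restrict_EFin.
have mfT : measurable_fun (setT : set (lebType R)) fT.
  by move/integrableP : intfT => [/measurable_EFinP].
have [g mg /lebesgue_ae_leb fg] := leb_measurable_borel_version mfT.
have intg : (leb R).-integrable setT (EFin \o g).
  by apply: leb_ae_integrable intfT => //; apply: leb_aeS fg => x ->.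
have intgl : (@lebesgue_measure R).-integrable setT (EFin \o g).
  by apply: borel_leb_integrable => //; exact/measurable_EFinP.
have intgy (y : R) : (@lebesgue_measure R).-integrable `[0, y] (EFin \o g).
  by apply: integrableS intgl.
have locg : locally_integrable [set: R] g.
  by apply: open_integrable_locally intgl; exact: openT.
have /lebesgue_ae_leb := @FTC1 R g (BLeft 0) intgy locg.
apply: (leb_aeS2 _ fg) => t fgt gt; rewrite in_itv/= => /andP[t0 tT].
have [|dg g'] := gt; first by rewrite lte_fin.
rewrite -[f t](_ : fT t = _); last first.
  by rewrite /fT patchE mem_set//= in_itv/= !ltW.
rewrite fgt -g' derive1E.
(* The primitives of [f] and of [g] are compared only for x <= T, since beyond T the extension by 0
   may differ from [f]. Near an interior point this is enough. *)
apply: near_eq_is_derive; last exact: derivableP.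
near=> x.
have xT : x <= T by near: x; exact: lt_le_nbhsl.
rewrite /Rintegral; congr fine.
rewrite -borel_leb_integral//; last 2 first.
  exact/measurable_EFinP.
  exact: integrableS intg.
apply: ae_eq_integral; first exact: mI.
- by apply/measurable_EFinP; apply: measurable_funTS; case/integrableP : intg =>
  /measurable_EFinP.
- by apply: (measurable_funS (mI `[0, T])); [exact: subset_itvl|case/integrableP
  : intf].
- apply: leb_aeS fg => s <- /=; rewrite in_itv/= => /andP[s0 sx].
  by rewrite /fT patchE mem_set//= in_itv/= s0 (le_trans sx).
Unshelve. all: by end_near. Qed.

End leb_complete.

(** * Measurability of superpositions t |-> g(t, w(t)) *)

Section superposition.
Context {R : realType} {d : nat}.
Implicit Types (g : R -> 'rV[R]_d -> R) (w : R -> 'rV[R]_d).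

(** [cell n x] indexes the cube of side 1/(n+1) containing x, and [grid] returns its lower corner:
    together they round x down to a countable lattice. *)
Let grid (n : nat) (z : 'rV[int]_d) : 'rV[R]_d :=
  \row_i ((z ord0 i)%:~R / n.+1%:R).

Let cell (n : nat) (x : 'rV[R]_d) : 'rV[int]_d :=
  \row_i Num.floor (n.+1%:R * x ord0 i).

Let grid_cell_cvg (x : 'rV[R]_d) : grid n (cell n x) @[n --> \oo] --> x.
Proof.
apply/cvgrPdist_le => /= e e0; near=> n.
rewrite [leLHS]/Num.Def.normr/= mx_normrE (bigmax_le _ (ltW e0))//= => -[i j] _.
rewrite !mxE/= ord1.
have n0 : 0 < n.+1%:R :> R by rewrite ltr0n.
have /andP[fl fr] := floor_itv (n.+1%:R * x ord0 j).
have ne : n.+1%:R^-1 <= e by apply: ltW; near: n; exact: (near_infty_natSinv_lt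
  (PosNum e0)).
apply: le_trans ne.
have -> : x ord0 j - (Num.floor (n.+1%:R * x ord0 j))%:~R / n.+1%:R =
    (n.+1%:R * x ord0 j - (Num.floor (n.+1%:R * x ord0 j))%:~R) / n.+1%:R.
  by rewrite mulrBl mulrAC divff ?mul1r// gt_eqF.
rewrite normrM normfV (gtr0_norm n0) ger0_norm ?subr_ge0//.
rewrite ler_pdivrMr// mulVf ?gt_eqF// lerBlDl.
by move: fr; rewrite intrD => /ltW.
Unshelve. all: by end_near. Qed.

(** Rounding [w] to the lattice gives functions with countably many values, for which measurability
    of [g] in t at each fixed x suffices; continuity in x passes to the limit at a.e. t. *)
Lemma leb_measurable_superposition (T : R) g w :
  (forall x, measurable_fun (`[0, T] : set (lebType R)) (g ^~ x)) ->
  {ae leb R, forall t, t \in `[0, T] -> continuous (g t)} ->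
  vmeasurable T w ->
  measurable_fun (`[0, T] : set (lebType R)) (fun t => g t (w t)).
Proof.
move=> mg cg mw.
apply: (@leb_ae_cvg_measurable _ _ (fun n t => g t (grid n (cell n (w t))))).
  move=> n mD B mB.
  rewrite (_ : _ `&` _ = \bigcup_(z in [set: 'rV[int]_d])
    ((\bigcap_(i in [set: 'I_d]) (`[0, T] `&` [set t | cell n (w t) ord0 i = z
      ord0 i]))
     `&` (`[0, T] `&` (g ^~ (grid n z)) @^-1` B))); last first.
    apply/seteqP; split => t /=.
      move=> [Dt Bt]; exists (cell n (w t)) => //; split => //.
    move=> [z _ [cz [Dt Bt]]]; split => //.
    rewrite (_ : cell n (w t) = z)//; apply/rowP => i.
    by have [] := cz i I.
  apply: countable_bigcupT_measurable => [|z]; first exact: countableP.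
  apply: measurableI; last exact: mg.
  apply: fin_bigcap_measurable => [|i _]; first exact: finite_finset.
  pose k : R := (z ord0 i)%:~R / n.+1%:R.
  rewrite (_ : [set t | _] = (fun t => w t ord0 i) @^-1`
     `[(z ord0 i)%:~R / n.+1%:R, (z ord0 i + 1)%:~R / n.+1%:R[).
    exact: mw.
  apply/seteqP; split => t /=; rewrite mxE in_itv/= ler_pdivrMr ?ltr0n//
    ltr_pdivlMr ?ltr0n// (mulrC _ n.+1%:R).
    by move=> /eqP; rewrite floor_eq.
  by rewrite -floor_eq => /eqP.
apply: leb_aeS cg => t + Dt => /(_ Dt) cg.
by apply: (@cvg_comp _ _ _ (fun n => grid n (cell n (w t))) (g t)); [exact:
  grid_cell_cvg|exact: cg].
Qed.

Lemma leb_measurable_comp (T : R) (f : 'rV[R]_d -> R) w :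
  continuous f -> vmeasurable T w ->
  measurable_fun (`[0, T] : set (lebType R)) (f \o w).
Proof.
move=> cf mw; apply: (leb_measurable_superposition (g := fun=> f)) => //.
by apply: aeW => t _.
Qed.

End superposition.

(** * The Euclidean norm *)

Section enorm.
Context {R : realType} {d : nat}.
Implicit Types (x y : 'rV[R]_d).

Lemma dotmulxx_ge0 x : 0 <= dotmul x x.
Proof. by apply: sumr_ge0 => i _; rewrite -expr2 sqr_ge0. Qed.

Lemma enorm_ge0 x : 0 <= enorm x.
Proof. exact: sqrtr_ge0. Qed.

Lemma enorm_sqr x : enorm x ^+ 2 = dotmul x x.
Proof. by rewrite sqr_sqrtr// dotmulxx_ge0. Qed.

Lemma coord_le_enorm x i : `|x ord0 i| <= enorm x.
Proof.
rewrite -sqrtr_sqr ler_wsqrtr// /dotmul (bigD1 i)//= -expr2 lerDl.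
by apply: sumr_ge0 => j _; rewrite -expr2 sqr_ge0.
Qed.

Lemma enorm_le_sum x : enorm x <= \sum_i `|x ord0 i|.
Proof.
have S0 : 0 <= \sum_i `|x ord0 i| by exact: sumr_ge0.
rewrite -(ler_pXn2r (_ : 0 < 2)%N) ?nnegrE ?enorm_ge0// enorm_sqr expr2 mulr_suml.
apply: ler_sum => i _; rewrite (le_trans (ler_norm _))// normrM ler_wpM2l//.
by rewrite (bigD1 i)//= lerDl sumr_ge0.
Qed.

Lemma norm_le_enorm x : `|x| <= enorm x.
Proof.
rewrite [leLHS]/Num.Def.normr/= mx_normrE bigmax_le ?enorm_ge0// => -[i j] _.
by rewrite ord1 coord_le_enorm.
Qed.

Lemma dotmulDl x y z : dotmul (x + y) z = dotmul x z + dotmul y z.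
Proof. by rewrite -big_split; apply: eq_bigr => i _; rewrite !mxE mulrDl. Qed.

Lemma dotmulZl a x y : dotmul (a *: x) y = a * dotmul x y.
Proof. by rewrite mulr_sumr; apply: eq_bigr => i _; rewrite !mxE mulrA. Qed.

Lemma dotmulC x y : dotmul x y = dotmul y x.
Proof. by apply: eq_bigr => i _; rewrite mulrC. Qed.

Lemma dotmulBl x y z : dotmul (x - y) z = dotmul x z - dotmul y z.
Proof. by rewrite -sumrB; apply: eq_bigr => i _; rewrite !mxE mulrBl. Qed.

Lemma dotmulBr x y z : dotmul x (y - z) = dotmul x y - dotmul x z.
Proof. by rewrite !(dotmulC x) dotmulBl. Qed.

Lemma dotmul_delta i x : dotmul (delta_mx ord0 i) x = x ord0 i.
Proof.
rewrite /dotmul (bigD1 i)//= big1 ?addr0 => [|j ji].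
  by rewrite mxE !eqxx mul1r.
by rewrite mxE (negbTE ji) mul0r.
Qed.

(** After squaring, this is c x_i <= |c| |x|. Perturbations run along one basis vector at a time, so
    this instance of the triangle inequality is the one used. *)
Lemma enormD_delta x c i :
  enorm (x + c *: delta_mx ord0 i) <= enorm x + `|c|.
Proof.
have s0 : 0 <= enorm x + `|c| by rewrite addr_ge0// enorm_ge0.
rewrite -(ler_pXn2r (_ : 0 < 2)%N) ?nnegrE ?enorm_ge0// enorm_sqr.
rewrite sqrrD enorm_sqr dotmulDl dotmulZl dotmul_delta dotmulC dotmulDl.
rewrite dotmulZl dotmul_delta !mxE !eqxx mulr1 -normrX (ger0_norm (sqr_ge0 c)).
have := ler_norm (c * x ord0 i); rewrite normrM => cx.
have : `|c| * `|x ord0 i| <= `|c| * enorm x by rewrite ler_wpM2l// coord_le_enorm.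
nra.
Qed.

(** The factor of [y] is its l1 norm; the superlinear growth of [Phi] absorbs any constant of this
    kind. *)
Lemma dotmul_le_enorm x y : dotmul x y <= enorm x * \sum_i `|y ord0 i|.
Proof.
rewrite mulr_sumr; apply: ler_sum => i _.
by rewrite (le_trans (ler_norm _))// normrM ler_wpM2r// coord_le_enorm.
Qed.

End enorm.

(** * Absolute continuity *)

Section absolute_continuity.
Context {R : realType} {d : nat}.
Implicit Types (T : R) (u : R -> 'rV[R]_d).

Lemma absolutely_continuous_uniform T u : absolutely_continuous T u ->
  forall e, 0 < e -> exists2 r, 0 < r &
    forall x y, 0 <= x -> x <= y -> y <= T -> y - x < r -> enorm (u y - u x) < e.
Proof.
move=> acu e e0; have [r r0 H] := acu e e0; exists r => // x y x0 xy yT yx.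
have := H 1%N (fun=> x) (fun=> y); rewrite !big_ord1; apply => //.
by move=> i j; rewrite !ord1 eqxx.
Qed.

Lemma absolutely_continuous_within T u : absolutely_continuous T u ->
  {within `[0, T], continuous u}.
Proof.
move=> acu; apply/subspace_continuousP => x /=.
rewrite in_itv/= => /andP[x0 xT].
apply/cvgrPdist_lt => e e0.
have [r r0 H] := absolutely_continuous_uniform acu e0.
near=> y.
have : y \in `[0, T] by near: y; exact: withinT.
rewrite in_itv/= => /andP[y0 yT].
have xyr : `|x - y| < r.
  by near: y; apply: cvg_within; exact: nbhsx_ballx.
have [xy|/ltW yx] := leP x y.
  rewrite distrC (le_lt_trans (norm_le_enorm _))// H//.
  by move: xyr; rewrite distrC ger0_norm// subr_ge0.
rewrite (le_lt_trans (norm_le_enorm _))// H//.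
by move: xyr; rewrite ger0_norm// subr_ge0.
Unshelve. all: by end_near. Qed.

Lemma within_continuous_vmeasurable T u :
  {within `[0, T], continuous u} -> vmeasurable T u.
Proof.
move=> cu i.
have mui : measurable_fun (`[0, T] : set (measurableTypeR R)) (fun t => u t ord0 i).
  apply: subspace_continuous_measurable_fun => //.
  move=> x.
  exact: (@continuous_comp (subspace `[0, T]) _ _ u (fun v : 'rV[R]_d => v ord0 i)
    x (cu x) (@coord_continuous _ _ _ _ _ _)).
move=> _ B mB; apply: borel_leb_measurable.
by apply: mui.
Qed.

Lemma within_continuous_bounded T u : 0 <= T ->
  {within `[0, T], continuous u} ->
  exists M, forall t, t \in `[0, T] -> `|u t| <= M.
Proof.
move=> T0 cu.
have [|c _ H] := @EVT_max R (fun t => `|u t|) 0 T T0.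
  move=> x; exact: (@continuous_comp (subspace `[0, T]) _ _ u
    (fun v : 'rV[R]_d => `|v|) x (cu x) (@norm_continuous _ _ _)).
by exists (`|u c|).
Qed.

(** Keeps the perturbed curves u + s eta e_i absolutely continuous. *)
Lemma absolutely_continuousD_delta T u (h : R -> R) (K : R) i :
  absolutely_continuous T u ->
  (forall x y, x <= y -> `|h y - h x| <= K * (y - x)) ->
  absolutely_continuous T (fun t => u t + h t *: delta_mx ord0 i).
Proof.
move=> acu lh e e0.
have e20 : 0 < e / 2 by rewrite divr_gt0.
have [r r0 H] := acu _ e20.
have K1 : 0 < `|K| + 1 by rewrite ltr_wpDl.
(* Half of [e] goes to [u], half to [h]; [|K| + 1] is positive whatever the sign of [K], so it can
   be divided by. *)
exists (Num.min r (e / 2 / (`|K| + 1))).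
  by rewrite lt_min r0 divr_gt0.
move=> n a b ab dis; rewrite lt_min => /andP[sr sK].
have {H}Hu := H n a b ab dis sr.
have Hh : \sum_(i < n) `|h (b i) - h (a i)| <= (`|K| + 1) * \sum_(i < n) (b i - a
  i).
  rewrite mulr_sumr; apply: ler_sum => j _; have [_ abj _] := ab j.
  rewrite (le_trans (lh _ _ abj))// ler_wpM2r ?subr_ge0//.
  by rewrite (le_trans (ler_norm _))// lerDl.
apply: (@le_lt_trans _ _ (\sum_(j < n) enorm (u (b j) - u (a j)) + \sum_(j < n)
  `|h (b j) - h (a j)|)).
  rewrite -big_split; apply: ler_sum => j _ /=.
  rewrite opprD addrACA -scalerBl; exact: enormD_delta.
rewrite (splitr e) ltrD// (le_lt_trans Hh)//.
by rewrite mulrC -ltr_pdivlMr.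
Qed.

Lemma leb_Rintegral_itvB T (f : R -> R) (a b : R) :
  (leb R).-integrable `[0, T] (EFin \o f) -> 0 <= a -> a <= b -> b <= T ->
  \int[leb R]_(t in `[0, b]) f t - \int[leb R]_(t in `[0, a]) f t =
  \int[leb R]_(t in `]a, b]) f t.
Proof.
move=> intf a0 ab bT.
have mI (i : interval R) : @measurable _ (lebType R) ([set` i] : set R).
  exact: leb_measurable_itv.
have -> : `[0, b]%classic = `[0, a]%classic `|` `]a, b]%classic.
  by rewrite -(@itv_bndbnd_setU _ _ _ (BRight a))// bnd_simp.
rewrite Rintegral_setU//; first by rewrite addrC addKr.
- apply: integrableS intf => //; first exact: measurableU.
  by move=> x /= []; rewrite !in_itv/= => /andP[]; lra.
- apply/disj_setPS => x /= []; rewrite !in_itv/= => /andP[_ xa] /andP[ax _].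
  by move: (lt_le_trans ax xa); rewrite ltxx.
Qed.

(** Absolute continuity of the integral of [\sum_i |f i|], applied to the union of the given
    intervals. *)
Lemma leb_integral_absolutely_continuous T (f : 'I_d -> R -> R) (c : 'rV[R]_d) :
  (forall i, (leb R).-integrable `[0, T] (EFin \o f i)) ->
  absolutely_continuous T
    (fun t => c + \row_i \int[leb R]_(s in `[0, t]) f i s).
Proof.
move=> intf e e0.
have mI (i : interval R) : @measurable _ (lebType R) ([set` i] : set R).
  exact: leb_measurable_itv.
pose G := (fun s => \sum_i `|f i s|) \_ `[0, T].
have intG0 : (leb R).-integrable `[0, T] (EFin \o (fun s => \sum_i `|f i s|)).
  rewrite (_ : _ \o _ = (fun s => \sum_i `|(EFin \o f i) s|%E)); last first.
    by apply/funext => s /=; rewrite sumEFin.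
  by apply: integrable_sum => // i _; exact/integrable_abse.
have intG : (leb R).-integrable setT (EFin \o G).
  by move/(integrable_mkcond _ (mI _)): intG0; rewrite restrict_EFin.
have [r [r0 H]] := integral_normr_continuous intG e0.
exists r => // n a b ab dis sr.
(* The given closed intervals may share endpoints; the half-open ones are disjoint and have the same
   lengths. *)
pose J k : set (lebType R) := `]a k, b k]%classic.
have mJ k : measurable (J k) by exact: mI.
have tJ : trivIset [set: 'I_n] J.
  apply/trivIsetP => i j _ _ ij; apply/seteqP; split => // x /= [].
  rewrite /J/= !in_itv/= => /andP[ai bi] /andP[aj bj].
  by case: (dis i j ij) => ?; lra.
have subJ k : J k `<=` `[0, T].
  move=> x; rewrite /J /= !in_itv/= => /andP[ax xb]; have [a0 _ bT] := ab k.
  by apply/andP; split; lra.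
pose A := \big[setU/set0]_(k < n) J k.
have mA : measurable A by exact: bigsetU_measurable.
have muA : (leb R A < r%:E)%E.
  rewrite /A measure_bigsetU_ord//.
  rewrite (eq_bigr (fun k => (b k - a k)%:E)) ?sumEFin ?lte_fin// => k _.
  rewrite [LHS](lebesgue_measure_itv `]a k, b k])/= lte_fin.
  case: ltP => [//|ba]; have [_ ab' _] := ab k.
  by rewrite (le_anti (introT andP (conj ab' ba))) subrr.
apply: le_lt_trans (H A mA muA).
have intJ k i : (leb R).-integrable (J k) (EFin \o f i) by exact: integrableS
  (intf i).
apply: (@le_trans _ _ (\sum_(k < n) \int[leb R]_(t in J k) `|G t|)).
  apply: ler_sum => k _; apply: (le_trans (enorm_le_sum _)).
  have -> : \int[leb R]_(t in J k) `|G t| = \sum_i \int[leb R]_(t in J k) `|f i t|.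
    transitivity (fine (\int[leb R]_(t in J k) (\sum_i `|(EFin \o f i) t|))%E).
      rewrite /Rintegral; congr fine; apply: eq_integral => t.
      rewrite inE => Jt; rewrite /G patchE mem_set; last exact: subJ Jt.
      by rewrite ger0_norm ?sumr_ge0// sumEFin.
    rewrite integral_sum//; last by move=> i; exact: integrable_abse.
    rewrite -sum_fine//= => i _.
    by apply: integrable_fin_num => //; exact: (integrable_abse (intJ k i)).
  apply: ler_sum => i _; rewrite !mxE opprD addrACA subrr add0r.
  have [a0 ab' bT] := ab k.
  rewrite (leb_Rintegral_itvB (intf i))//.
  exact: (le_normr_Rintegral (mJ k) (intJ k i)).
have intGJ k : (leb R).-integrable (J k) (EFin \o (fun t => `|G t|)).
  by apply: integrableS (integrable_norm intG).
rewrite /Rintegral (ge0_integral_bigsetU _ mJ); first last.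
- by move=> t _; rewrite lee_fin normr_ge0.
- by apply: measurable_funTS; case/integrableP: (integrable_norm intG).
- exact: sub_trivIset tJ.
- exact: index_enum_uniq.
rewrite -sum_fine; first exact: lexx.
by move=> k _; exact: (integrable_fin_num (mJ k) (intGJ k)).
Qed.

End absolute_continuity.

(** * Strict convexity and the inverse of the gradient *)

Section directional_derivatives.
Context {R : realType} {d : nat}.
Implicit Types (f : 'rV[R]_d -> R) (x y v : 'rV[R]_d).

Lemma cvg_natSinv_dnbhs : (n.+1%:R^-1 : R) @[n --> \oo] --> (0 : R)^'.
Proof.
move=> A [e /= e0 eA]; have := near_infty_natSinv_lt (PosNum e0).
apply: filterS => n /= ne; apply: eA => /=.
  by rewrite sub0r normrN ger0_norm.
by rewrite invr_neq0// pnatr_eq0.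
Qed.

(** Puts derivatives in the sequential form that measurable limits and dominated convergence
    require. *)
Lemma derivable_cvg_seq (V W : normedModType R) (f : V -> W) (x v : V) :
  derivable f x v ->
  n.+1%:R *: (f (n.+1%:R^-1 *: v + x) - f x) @[n --> \oo] --> 'D_v f x.
Proof.
move=> fxv.
have := cvg_comp (fun n => n.+1%:R^-1 : R)
  (fun h : R => h^-1 *: ((f \o shift x) (h *: v) - f x)) cvg_natSinv_dnbhs fxv.
rewrite (_ : _ \o _ = (fun n => n.+1%:R *: (f (n.+1%:R^-1 *: v + x) - f x)))//.
by apply/funext => n /=; rewrite invrK.
Qed.

Lemma derive_dotmul f x v : differentiable f x -> 'D_v f x = dotmul v (grad f x).
Proof.
move=> df; rewrite deriveE// [in LHS](row_sum_delta v) linear_sum.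
apply: eq_bigr => i _; rewrite linearZ mxE deriveE//.
Qed.

End directional_derivatives.

Section strict_convexity.
Context {R : realType} {d : nat}.
Implicit Types (f : 'rV[R]_d -> R) (x y v w z : 'rV[R]_d).

Lemma strictly_convex_le f x y (t : R) : strictly_convex f -> 0 <= t <= 1 ->
  f (t *: x + (1 - t) *: y) <= t * f x + (1 - t) * f y.
Proof.
move=> cf /andP[]; rewrite le_eqVlt => /predU1P[<- _|t0].
  by rewrite scale0r subr0 scale1r !add0r mul0r mul1r add0r.
rewrite le_eqVlt => /predU1P[->|t1].
  by rewrite scale1r subrr scale0r addr0 mul0r mul1r addr0.
have [->|xy] := eqVneq x y; last by apply/ltW/cf; rewrite ?t0.
by rewrite -scalerDl -mulrDl addrCA subrr addr0 scale1r mul1r.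
Qed.

(** x + s v is the convex combination of x + v and x with weights s and 1 - s. With the next lemma
    it bounds the quotient at step s uniformly in s in ]0, 1]. *)
Lemma strictly_convex_right_quotient f x v (s : R) : strictly_convex f ->
  0 <= s <= 1 -> f (x + s *: v) - f x <= s * (f (x + v) - f x).
Proof.
move=> cf s01; have := strictly_convex_le (x + v) x cf s01.
rewrite (_ : s *: (x + v) + _ = x + s *: v); first by lra.
by rewrite scalerDr scalerBl scale1r addrC addrA subrK.
Qed.

(** x is the convex combination of x + s v and x - v with weights 1/(1+s) and s/(1+s). *)
Lemma strictly_convex_left_quotient f x v (s : R) : strictly_convex f ->
  0 <= s <= 1 -> s * (f x - f (x - v)) <= f (x + s *: v) - f x.
Proof.
move=> cf /andP[s0 s1].
have s10 : 0 < 1 + s by lra.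
have t01 : 0 <= (1 + s)^-1 <= 1 by rewrite invr_ge0 ltW//= invf_le1//; lra.
have := strictly_convex_le (x + s *: v) (x - v) cf t01.
have -> : 1 - (1 + s)^-1 = (1 + s)^-1 * s.
  by field; rewrite gt_eqF.
rewrite -scalerA -scalerDr.
rewrite (_ : x + s *: v + s *: (x - v) = (1 + s) *: x); last first.
  by rewrite scalerBr scalerDl scale1r addrACA -addrA addrCA subrr addr0 addrC.
rewrite scalerA mulVf ?gt_eqF// scale1r -mulrA -mulrDr ler_pdivlMl//.
by lra.
Qed.

Lemma dotmul_continuous z : continuous (dotmul ^~ z).
Proof.
move=> x; apply: continuous_big => [|i _ y]; first exact: add_continuous.
apply: (@continuousM R _ (fun x : 'rV[R]_d => x ord0 i) (cst (z ord0 i)) y).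
  exact: coord_continuous.
exact: cst_continuous.
Qed.

(** [w] attains the supremum defining [complementary f z], the equality case of the Fenchel-Young
    inequality. For convex differentiable [f] this amounts to grad f(w) = z, so inverting the
    gradient becomes a minimisation. *)
Definition tilted_minimum f z w := forall y, f w - dotmul w z <= f y - dotmul y z.

Lemma tilted_minimum_uniq f z w w' : strictly_convex f ->
  tilted_minimum f z w -> tilted_minimum f z w' -> w = w'.
Proof.
move=> cf mw mw'; apply/eqP; apply/negP => /negP ww'.
have t01 : 0 < (2^-1 : R) < 1 by lra.
have := @cf w w' _ ww' t01.
have := mw (2^-1 *: w + (1 - 2^-1) *: w').
have := mw' w; have := mw w'.
rewrite dotmulDl !dotmulZl; lra.
Qed.

(** First-order condition: every directional derivative of the tilted function is nonnegative at
    [w], and the directions e_i and - e_i together force equality. *)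
Lemma tilted_minimum_grad f z w : differentiable f w ->
  tilted_minimum f z w -> grad f w = z.
Proof.
move=> df mw.
have ge v : dotmul v z <= dotmul v (grad f w).
  have := @derivable_cvg_seq _ _ _ f w v (diff_derivable df).
  rewrite derive_dotmul// => fv; rewrite -(cvg_lim _ fv)//.
  apply: limr_ge; first by apply/cvg_ex; exists (dotmul v (grad f w)).
  apply: nearW => n; rewrite -[leRHS]/(_ * _) -ler_pdivrMl// lerBrDr.
  have := mw (n.+1%:R^-1 *: v + w); rewrite dotmulDl dotmulZl; set q :=
    n.+1%:R^-1 * _ => ?.
  by lra.
apply/rowP => i.
have := ge (delta_mx ord0 i); have := ge (- delta_mx ord0 i).
rewrite -scaleN1r !dotmulZl !dotmul_delta => ? ?.
by apply/le_anti/andP; split; lra.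
Qed.

(** A convex function lies above its tangent plane: quotients in the direction y - w at steps at
    most 1 are bounded by f(y) - f(w). *)
Lemma grad_tilted_minimum f z w : strictly_convex f -> differentiable f w ->
  grad f w = z -> tilted_minimum f z w.
Proof.
move=> cf df <- y.
have fv := @derivable_cvg_seq _ _ _ f w (y - w) (diff_derivable df).
have : 'D_(y - w) f w <= f y - f w.
  rewrite -(cvg_lim _ fv)//.
  apply: limr_le; first by apply/cvg_ex; exists ('D_(y - w) f w).
  apply: nearW => n; rewrite -[leLHS]/(_ * _) -ler_pdivlMl// [_ + w]addrC.
  have n01 : 0 <= (n.+1%:R^-1 : R) <= 1.
    by rewrite invr_ge0 ler0n/= invf_le1// ler1n.
  have := strictly_convex_right_quotient w (y - w) cf n01.
  by rewrite [w + (y - w)]addrC subrK.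
rewrite derive_dotmul// dotmulBl; lra.
Qed.

(** Superlinearity with slope [K], the l1 norm of [z], makes the tilted function nonnegative outside
    a ball. Its value at 0 is 0, so a minimum over the compact ball is global. *)
Lemma tilted_minimum_exists f z : continuous f -> f 0 = 0 ->
  f y / enorm y @[y --> enorm_pinfty] --> +oo_R ->
  exists w, tilted_minimum f z w.
Proof.
move=> cf f0 fz.
pose K := \sum_i `|z ord0 i|.
have [M HM] : exists M : R, forall x, M < enorm x -> K < f x / enorm x.
  by apply: (fz [set y | K < y]); exists K; split; [exact: num_real|].
(* The maximum with 0 puts the origin in the ball and makes [enorm y] positive outside, as the
   division requires. *)
pose M' := Num.max M 0.
pose A : set 'rV[R]_d := [set y | `|y| <= M'].
have A0 : A 0 by rewrite /A /= normr0 le_max lexx orbT.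
have cA : compact A.
  apply: bounded_closed_compact.
    by exists M'; split => [|N MN x /= /le_trans]; [exact: num_real|apply; exact:
      ltW].
  apply: (@preimage_closed _ _ (fun y : 'rV[R]_d => `|y|) [set r | r <= M']).
    by move=> x _; exact: norm_continuous.
  exact: closed_le.
have [|c cA' cmin] := @EVT_min_rV R d (fun y => f y - dotmul y z) A (ex_intro _ 0
  A0) cA.
  apply: continuous_subspaceT => x; apply: (@continuousB R R^o _ f (dotmul ^~ z)
    x); [exact: cf|exact: dotmul_continuous].
exists c => y; have [yA|yA] := pselect (A y); first by apply: cmin; rewrite inE.
apply: (@le_trans _ _ 0).
  have : (0 : 'rV[R]_d) \in A by rewrite inE.
  have dot0 : dotmul 0 z = 0 by rewrite /dotmul big1// => i _; rewrite mxE mul0r.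
  by move/cmin; rewrite f0 dot0 subr0.
rewrite subr_ge0.
have yM : M' < enorm y.
  by apply: lt_le_trans (norm_le_enorm y); rewrite ltNge; apply/negP.

have [My y0] : M < enorm y /\ 0 < enorm y by move: yM; rewrite gt_max => /andP.
have := HM y My; rewrite ltr_pdivlMr// => Kf.
by rewrite (le_trans (dotmul_le_enorm _ _))// mulrC ltW.
Qed.

Let dotmul_le_norm x y : dotmul x y <= (d%:R * `|x|) * (d%:R * `|y|).
Proof.
have le v : \sum_i `|v ord0 i| <= d%:R * `|v|.
  rewrite mulr_natl -[X in _ *+ X](card_ord d) -sumr_const; apply: ler_sum => i _.
  rewrite [leRHS]/Num.Def.normr/= mx_normrE.
  exact: (le_bigmax _ (fun ij => `|v ij.1 ij.2|) (ord0, i)).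
apply: (le_trans (dotmul_le_enorm x y)); apply: ler_pM => //.
- exact: enorm_ge0.
- exact: sumr_ge0.
- exact: le_trans (enorm_le_sum x) (le x).
Qed.

(** On the sphere of radius [e] about [w0] the function tilted by [z0] exceeds its minimum by some
    [mu > 0], by compactness and uniqueness. If [g z] lay on or beyond the sphere, convexity would
    give a point of it where the function tilted by [z] is at most its value at [w0]; a tilt that
    changes by too little to compensate [mu] forbids this. *)
Lemma tilted_minimum_continuous f (g : 'rV[R]_d -> 'rV[R]_d) :
  continuous f -> strictly_convex f ->
  (forall z, tilted_minimum f z (g z)) -> continuous g.
Proof.
move=> cf sf mg z0; set w0 := g z0.
apply/(cvgrPdist_lt (FF := nbhs_filter (z0 : 'rV[R]_d))) => e e0.
pose S : set 'rV[R]_d := [set y | `|y - w0| = e].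
have [mu mu0 Hmu] : exists2 mu : R, 0 < mu & forall y, S y ->
    f w0 - dotmul w0 z0 + mu <= f y - dotmul y z0.
  (* The sphere is empty when d = 0, and then any positive [mu] will do. *)
  have [[y0 Sy0]|S0] := pselect (exists y, S y); last first.
    by exists 1 => // y Sy; case: S0; exists y.
  have cS : compact S.
    apply: bounded_closed_compact.
      exists (`|w0| + e); split => [|N MN x Sx /=]; first exact: num_real.
      apply: le_trans (ltW MN); rewrite -[x](subrK w0) addrC.
      by rewrite (le_trans (ler_normD _ _))// lerD2l Sx.
    apply: (@preimage_closed _ _ (fun y : 'rV[R]_d => `|y - w0|) [set r | r = e]).
      move=> x _; apply: (@continuous_comp _ _ _ (fun y => y - w0) (fun y :
        'rV[R]_d => `|y|)).
        by apply: (@continuousB R _ _ id (cst w0) x); [exact: cvg_id|exact: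
          cst_continuous].
      exact: norm_continuous.
    exact: closed_eq.
  have [|c cS' cmin] := @EVT_min_rV R d (fun y => f y - dotmul y z0) S (ex_intro
    _ y0 Sy0) cS.
    by apply: continuous_subspaceT => x; apply: (@continuousB R R^o _ f (dotmul
      ^~ z0) x); [exact: cf|exact: dotmul_continuous].
  exists ((f c - dotmul c z0) - (f w0 - dotmul w0 z0)); last first.
    by move=> y Sy; rewrite subrKC; apply: cmin; rewrite inE.
  rewrite subr_gt0 ltNge; apply/negP => cw0.
  have mc : tilted_minimum f z0 c by move=> y; exact: le_trans cw0 (mg z0 y).
  have cE := tilted_minimum_uniq sf mc (mg z0).
  move: cS'; rewrite inE /S /= cE subrr normr0 => e0'.
  by move: e0; rewrite -e0' ltxx.
(* The constant of [dotmul_le_norm] once its first argument has norm [e]. *)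
pose K : R := d%:R * e * d%:R.
have K0 : 0 <= K by rewrite !mulr_ge0// ltW.
have K1 : 0 < K + 1 by rewrite ltr_wpDl.
near=> z.
have zr : `|z0 - z| < mu / (K + 1).
  near: z; have /(cvgrPdist_lt (FF := nbhs_filter (z0 : 'rV[R]_d))) : id @ z0 -->
    z0.
    exact: cvg_id.
  by apply; rewrite divr_gt0.
rewrite ltNge; apply/negP => ew.
have nw0 : 0 < `|g z - w0| by rewrite distrC; exact: lt_le_trans ew.
(* The fraction of the segment from [w0] to [g z] at which it meets the sphere. *)
pose s := e / `|g z - w0|.
have s01 : 0 <= s <= 1.
  apply/andP; split; first by rewrite divr_ge0// ltW.
  by rewrite ler_pdivrMr// mul1r distrC.
pose y := s *: g z + (1 - s) *: w0.
have yw : y - w0 = s *: (g z - w0).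
  by rewrite /y scalerBl scale1r scalerBr -addrA addrAC subrr add0r.
have Sy : S y.
  rewrite /S /= yw normrZ ger0_norm; last by case/andP: s01.
  by rewrite divfK// gt_eqF.
have h1 := Hmu y Sy.
have h2 : dotmul (y - w0) (z - z0) < mu.
  apply: (le_lt_trans (dotmul_le_norm _ _)).
  rewrite Sy mulrA distrC -/K.
  apply: (@le_lt_trans _ _ ((K + 1) * `|z0 - z|)); first by rewrite ler_wpM2r//
    lerDl.
  by rewrite mulrC -ltr_pdivlMr.
have h3 := strictly_convex_le (g z) w0 sf s01.
have h4 := mg z w0.
move: h1 h2 h3; rewrite -/y.
have -> : dotmul (y - w0) (z - z0) = dotmul y z - dotmul w0 z - dotmul y z0 +
  dotmul w0 z0.
  by rewrite dotmulBr !dotmulBl; ring.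
have -> : dotmul y z = s * dotmul (g z) z + (1 - s) * dotmul w0 z.
  by rewrite /y dotmulDl !dotmulZl.
have /andP[s0 _] := s01; move: h4; rewrite -subr_ge0 => /(mulr_ge0 s0).
nra.
Unshelve. all: by end_near. Qed.

End strict_convexity.

(** * The du Bois-Reymond lemma *)

Section ramp.
Context {R : realType}.
Implicit Types (s e t x y : R).

Definition ramp s e t : R := Num.max 0 (Num.min 1 ((t - s) / e)).

(** The a.e. derivative of [ramp]. The interval is half-open to match [leb_Rintegral_itvB]; the
    values at the two kinks are immaterial. *)
Definition slope s e t : R := if t \in `]s, s + e] then e^-1 else 0.

Lemma ramp_before s e t : 0 < e -> t <= s -> ramp s e t = 0.
Proof.
move=> e0 ts; rewrite /ramp; apply/max_idPl; rewrite ge_min; apply/orP; right.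
by rewrite ler_pdivrMr// mul0r subr_le0.
Qed.

Lemma ramp_after s e t : 0 < e -> s + e <= t -> ramp s e t = 1.
Proof.
move=> e0 ts; rewrite /ramp (_ : Num.min _ _ = 1) ?(max_idPr _)//.
by apply/min_idPl; rewrite ler_pdivlMr// mul1r lerBrDl.
Qed.

Lemma ramp_between s e t : 0 < e -> s <= t -> t <= s + e -> ramp s e t = (t - s)
  / e.
Proof.
move=> e0 st te; rewrite /ramp (_ : Num.min _ _ = (t - s) / e).
  by apply/max_idPr; rewrite divr_ge0// ?subr_ge0// ltW.
by apply/min_idPr; rewrite ler_pdivrMr// mul1r lerBlDl.
Qed.

Lemma ramp_ge0_le1 s e t : 0 <= ramp s e t <= 1.
Proof. by rewrite /ramp le_max lexx/= ge_max ler01/= ge_min lexx. Qed.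

Lemma ramp_lipschitz s e x y : 0 < e -> x <= y ->
  `|ramp s e y - ramp s e x| <= e^-1 * (y - x).
Proof.
move=> e0 xy.
have : (x - s) / e <= (y - s) / e by rewrite ler_pM2r ?invr_gt0// lerD2r.
have -> : e^-1 * (y - x) = (y - s) / e - (x - s) / e by rewrite -mulrBl mulrC;
  congr (_ * _); ring.
rewrite /ramp; move: ((x - s) / e) ((y - s) / e) => a b ab.
rewrite ger0_norm.
  by rewrite /Num.max /Num.min; repeat case: ifPn => //; rewrite -?leNgt; lra.
by rewrite subr_ge0; rewrite /Num.max /Num.min; repeat case: ifPn => //; rewrite
  -?leNgt; lra.
Qed.

Lemma slope_bounded s e t : 0 < e -> `|slope s e t| <= e^-1.
Proof.
move=> e0; rewrite /slope; case: ifPn => _.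
  by rewrite ger0_norm// invr_ge0 ltW.
by rewrite normr0 invr_ge0 ltW.
Qed.

Lemma is_derive_ramp s e t : 0 < e -> t != s -> t != s + e ->
  is_derive t 1 (ramp s e) (slope s e t).
Proof.
move=> e0 ts tse; rewrite /slope in_itv/=.
have [st|st|/eqP] := ltgtP s t; last by rewrite eq_sym (negbTE ts).
  have [te|te|/eqP] := ltgtP t (s + e); last by rewrite (negbTE tse).
    apply: (@near_eq_is_derive _ _ _ (fun t => (t - s) / e)).
      near=> x; rewrite ramp_between//; apply: ltW; near: x.
        exact: lt_nbhsr.
      exact: lt_nbhsl.
    by apply: is_derive_eq; rewrite scaler0 add0r subr0 /GRing.scale/= mulr1.
  rewrite /=; apply: (@near_eq_is_derive _ _ _ (fun _ : R => 1 : R)).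
    near=> x; rewrite ramp_after//; apply: ltW; near: x; exact: lt_nbhsr.
rewrite /=; apply: (@near_eq_is_derive _ _ _ (fun _ : R => 0 : R)).
  near=> x; rewrite ramp_before//; apply: ltW; near: x; exact: lt_nbhsl.
Unshelve. all: by end_near. Qed.

Lemma borel_measurable_leb (D : set R) (f : R -> R) :
  measurable_fun (setT : set R) f ->
  measurable_fun (D : set (lebType R)) f.
Proof.
move=> mf; apply: measurable_funTS => _ B mB; rewrite setTI.
apply: borel_leb_measurable.
by rewrite -[X in measurable X]setTI; exact: mf.
Qed.

Lemma measurable_ramp s e (D : set R) : measurable_fun (D : set (lebType R))
  (ramp s e).
Proof.
apply: borel_measurable_leb; apply: measurable_maxr => //.
apply: measurable_minr => //; apply: measurable_funM => //.
exact: measurable_funB.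
Qed.

Lemma measurable_slope s e (D : set R) : measurable_fun (D : set (lebType R))
  (slope s e).
Proof.
apply: borel_measurable_leb.
rewrite (_ : slope s e = (fun t => e^-1 * \1_(`]s, s + e]%classic) t)); last first.
  apply/funext => t; rewrite /slope indicE /=.
  by rewrite mem_setE; case: ifPn; rewrite ?mulr1 ?mulr0.
by apply: measurable_funM => //; apply: measurable_indic.
Qed.

Lemma leb_ae_neq s : {ae leb R, forall t, t != s}.
Proof.
apply: lebesgue_ae_leb; exists [set s]; split => //.
  exact: lebesgue_measure_set1.
by move=> t /= /negP; rewrite negbK => /eqP.
Qed.

End ramp.
Section du_bois_reymond.
Context {R : realType}.
Variable T : R.
Implicit Types (f g h k : R -> R).

(** The derivative is carried as a separate function [k], measurable on [0, T], bounded everywhere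
    and equal to h' only a.e., because ramps have kinks. The last clause makes u + s h e_i periodic
    when u is. *)
Definition lipschitz_test h k : Prop := exists K : R,
  [/\ forall x y, x <= y -> `|h y - h x| <= K * (y - x),
      forall t, `|k t| <= K,
      measurable_fun (`[0, T] : set (lebType R)) k,
      {ae leb R, forall t, t \in `]0, T[ -> is_derive t 1 h (k t)} &
      h 0 = h T].

Let mI (i : interval R) : @measurable _ (lebType R) ([set` i] : set R).
Proof. exact: leb_measurable_itv. Qed.

Lemma leb_integrableMbounded g k (K : R) :
  (leb R).-integrable `[0, T] (EFin \o g) ->
  measurable_fun (`[0, T] : set (lebType R)) k -> (forall t, `|k t| <= K) ->
  (leb R).-integrable `[0, T] (EFin \o (fun t => g t * k t)).
Proof.
move=> ig mk kK.
rewrite (_ : _ \o _ = (EFin \o g) \* (EFin \o k))%E//.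
apply: integrableMl => //.
by exists K; split; [exact: num_real|move=> N KN t _; exact: le_trans (kK t) (ltW
  KN)].
Qed.

Lemma lipschitz_test_cst (c : R) : lipschitz_test (cst c) (cst 0).
Proof.
exists 0; split.
- by move=> x y _; rewrite subrr normr0 mul0r.
- by move=> t; rewrite normr0.
- exact: measurable_cst.
- by apply: aeW => t _; exact: (is_derive_cst c t 1).
- by [].
Qed.

Lemma lipschitz_test_rampB (s r e : R) : 0 < s -> 0 < r -> 0 < e ->
  s + e <= T -> r + e <= T ->
  lipschitz_test (fun t => ramp s e t - ramp r e t)
                 (fun t => slope s e t - slope r e t).
Proof.
move=> s0 r0 e0 sT rT; exists (e^-1 + e^-1); split.
- move=> x y xy; rewrite mulrDl.
  rewrite (_ : ramp s e y - ramp r e y - (ramp s e x - ramp r e x) =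
    (ramp s e y - ramp s e x) - (ramp r e y - ramp r e x)); last by ring.
  by rewrite (le_trans (ler_normB _ _))// lerD// ramp_lipschitz.
- by move=> t; rewrite (le_trans (ler_normB _ _))// lerD// slope_bounded.
- by apply: measurable_funB; exact: measurable_slope.
- have dr x := leb_aeS2 (fun t a b => is_derive_ramp e0 a b)
    (leb_ae_neq x) (leb_ae_neq (x + e)).
  by apply: leb_aeS2 (dr s) (dr r) => t ds dr' _; exact: is_deriveB.
- rewrite (ramp_before e0 (ltW s0)) (ramp_before e0 (ltW r0)).
  by rewrite (ramp_after e0 sT) (ramp_after e0 rT) !subrr.
Qed.

Variables f g : R -> R.
Hypothesis intf : (leb R).-integrable `[0, T] (EFin \o f).
Hypothesis intg : (leb R).-integrable `[0, T] (EFin \o g).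

Let P f t := \int[leb R]_(s in `[0, t]) f s.

Let integrable_slope s e : 0 < e ->
  (leb R).-integrable `[0, T] (EFin \o (fun t => g t * slope s e t)).
Proof.
move=> e0; apply: (leb_integrableMbounded (K := e^-1)) => //.
  exact: measurable_slope.
by move=> t; exact: slope_bounded.
Qed.

Let integrable_ramp s e :
  (leb R).-integrable `[0, T] (EFin \o (fun t => f t * ramp s e t)).
Proof.
apply: (leb_integrableMbounded (K := 1)) => //; first exact: measurable_ramp.
by move=> t; have /andP[r0 r1] := ramp_ge0_le1 s e t; rewrite ger0_norm.
Qed.

(** Integrating against the derivative of a ramp yields a difference quotient of the primitive,
    which converges wherever the primitive is differentiable. *)
Let integral_slope s e : 0 < s -> 0 < e -> s + e <= T ->
  \int[leb R]_(t in `[0, T]) (g t * slope s e t) = e^-1 * (P g (s + e) - P g s).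
Proof.
move=> s0 e0 sT; rewrite /P (leb_Rintegral_itvB intg (ltW s0) _ sT); last by
  rewrite lerDl ltW.
have sub : `]s, s + e] `<=` `[0, T].
  by move=> t /=; rewrite !in_itv/= => /andP[? ?]; apply/andP; split; lra.
rewrite -RintegralZl//; last exact: integrableS intg.
rewrite -{1}(setIidr sub) Rintegral_mkcondr; apply: eq_Rintegral => t _.
rewrite patchE /slope mem_setE; case: ifPn; rewrite ?mulr0//.
by rewrite mulrC.
Qed.

Let cvg_integral_slope s : s \in `]0, T[ -> is_derive s 1 (P g) (g s) ->
  \int[leb R]_(t in `[0, T]) (g t * slope s n.+1%:R^-1 t) @[n --> \oo] --> g s.
Proof.
rewrite in_itv/= => /andP[s0 sT] dg.
have := @derivable_cvg_seq _ _ _ (P g) s 1 (ex_derive (is_derive := dg)).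
rewrite derive_val; apply: cvg_trans.
apply: near_eq_cvg; near=> n.
have nT : n.+1%:R^-1 < T - s.
  by near: n; apply: (near_infty_natSinv_lt (PosNum (_ : 0 < T - s))); rewrite
    subr_gt0.
rewrite integral_slope// ?invr_gt0//; last by rewrite -lerBrDl ltW.
by rewrite invrK; congr (_ * (P g _ - _)); rewrite addrC /GRing.scale/= mulr1.
Unshelve. all: by end_near. Qed.

(** The ramps tend to the indicator of ]s, T], dominated by 1; at each t of [0, T] the sequence is
    eventually constant. *)
Let cvg_integral_ramp s : s \in `]0, T[ ->
  \int[leb R]_(t in `[0, T]) (f t * ramp s n.+1%:R^-1 t) @[n --> \oo] -->
    P f T - P f s.
Proof.
rewrite in_itv/= => /andP[s0 sT].
rewrite /P (leb_Rintegral_itvB intf (ltW s0) (ltW sT))//.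
have sub : `]s, T] `<=` `[0, T].
  by move=> t /=; rewrite !in_itv/= => /andP[? ?]; apply/andP; split; lra.
have intl : (leb R).-integrable `[0, T] (EFin \o (f \_ `]s, T])).
  rewrite -restrict_EFin; apply/integrable_restrict; [exact: mI|exact: mI|].
  by rewrite setIidr//; exact: integrableS intf.
rewrite -(setIidr sub) Rintegral_mkcondr.
have [] := @dominated_convergence _ _ _ (leb R) `[0, T] (mI _)
  (fun n t => (f t * ramp s n.+1%:R^-1 t)%:E) (fun t => ((f \_ `]s, T]) t)%:E)
  (fun t => `|(f t)%:E|%E).
- by move=> n; case/integrableP : (integrable_ramp s n.+1%:R^-1).
- by case/integrableP : intl.
- apply: aeW => t; rewrite /= in_itv/= => /andP[t0 tT].
  apply: cvg_EFin; first exact: nearW.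
  have [st|ts] := ltP s t; last first.
    apply: cvg_near_cst; apply: nearW => n /=.
    by rewrite patchE mem_setE in_itv/= ltNge ts/= ramp_before ?mulr0// invr_gt0.
  apply: cvg_near_cst; near=> n => /=.
  rewrite patchE mem_setE in_itv/= tT st/= ramp_after ?mulr1//.
  rewrite -lerBrDl ltW//; near: n.
  have ts : 0 < t - s by rewrite subr_gt0.
  exact: (near_infty_natSinv_lt (PosNum ts)).
- exact: integrable_abse.
- apply: aeW => t n _; rewrite lee_fin normrM.
  have /andP[r0 r1] := ramp_ge0_le1 s n.+1%:R^-1 t.
  by rewrite (ger0_norm r0) ler_piMr.
move=> _ _ cvgI; apply: fine_cvg.
by rewrite fineK//; exact: integrable_fin_num.
Unshelve. all: by end_near. Qed.

Lemma du_bois_reymond :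
  (forall h k, lipschitz_test h k ->
    \int[leb R]_(t in `[0, T]) (g t * k t + f t * h t) = 0) ->
  P f T = 0 /\
  exists c : R, {ae leb R, forall t, t \in `[0, T] -> g t = c + P f t}.
Proof.
move=> weak; split.
  rewrite -[RHS](weak _ _ (lipschitz_test_cst 1)) /P.
  by apply: eq_Rintegral => t _; rewrite mulr0 add0r mulr1.
(* The ramps at s and at r, subtracted and made infinitely steep, show that g - P f takes the same
   value at any two points where P g is differentiable with derivative g. *)
have L s r : s \in `]0, T[ -> is_derive s 1 (P g) (g s) ->
    r \in `]0, T[ -> is_derive r 1 (P g) (g r) ->
    g s + (P f T - P f s) = g r + (P f T - P f r).
  move=> sT ds rT dr.
  pose u x n : R := \int[leb R]_(t in `[0, T]) (g t * slope x n.+1%:R^-1 t) +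
    \int[leb R]_(t in `[0, T]) (f t * ramp x n.+1%:R^-1 t).
  have cu x : x \in `]0, T[ -> is_derive x 1 (P g) (g x) ->
      u x n @[n --> \oo] --> g x + (P f T - P f x).
    by move=> xT dx; apply: cvgD; [exact: cvg_integral_slope|exact:
      cvg_integral_ramp].
  suff csr : u s n @[n --> \oo] --> g r + (P f T - P f r).
    by rewrite -(cvg_lim _ csr)//; apply/esym/cvg_lim => //; exact: cu.
  apply: cvg_trans (cu _ rT dr); apply: near_eq_cvg; near=> n.
  have n0 : 0 < n.+1%:R^-1 :> R by rewrite invr_gt0.
  have lt_T (x e : R) : x \in `]0, T[ -> e < T - x -> 0 < x /\ x + e <= T.
    by rewrite in_itv/= => /andP[? ?] ?; split; lra.
  have [s0 sT'] : 0 < s /\ s + n.+1%:R^-1 <= T.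
    apply: lt_T => //; near: n; apply: (near_infty_natSinv_lt (PosNum (_ : 0 < T
      - s))).
    by rewrite subr_gt0; move: sT; rewrite in_itv/= => /andP[].
  have [r0 rT'] : 0 < r /\ r + n.+1%:R^-1 <= T.
    apply: lt_T => //; near: n; apply: (near_infty_natSinv_lt (PosNum (_ : 0 < T
      - r))).
    by rewrite subr_gt0; move: rT; rewrite in_itv/= => /andP[].
  have := weak _ _ (lipschitz_test_rampB s0 r0 n0 sT' rT').
  pose A x t := g t * slope x n.+1%:R^-1 t.
  pose B x t := f t * ramp x n.+1%:R^-1 t.
  rewrite (_ : Rintegral _ _ _ =
     \int[leb R]_(t in `[0, T]) ((A s t + B s t) - (A r t + B r t))); last first.
    by apply: eq_Rintegral => t _; rewrite /A /B; ring.
  have iA x : (leb R).-integrable `[0, T] (EFin \o A x) by exact: integrable_slope.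
  have iB x : (leb R).-integrable `[0, T] (EFin \o B x) by exact: integrable_ramp.
  have iAB x : (leb R).-integrable `[0, T] (EFin \o (fun t => A x t + B x t)).
    by rewrite (_ : _ \o _ = (EFin \o A x) \+ (EFin \o B x))%E//; exact:
      integrableD.
  rewrite RintegralB// !RintegralD// => /eqP; rewrite subr_eq0 => /eqP.
  by [].
have good : {ae leb R, forall t, t \in `[0, T] ->
    (t \in `]0, T[) /\ is_derive t 1 (P g) (g t)}.
  apply: leb_aeS3 (leb_ae_neq 0) (leb_ae_neq T) (leb_FTC1 intg) => t t0 tT dg.
  rewrite in_itv/= => /andP[t0' tT'].
  have t0T : t \in `]0, T[ by rewrite in_itv/= !lt_neqAle eq_sym t0 tT t0'.
  by split=> //; exact: dg.
(* One such point fixes the constant. If there is none, the a.e. claim is vacuous and 0 serves. *)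
have [[s [sT ds]]|nos] := pselect (exists s, (s \in `]0, T[) /\ is_derive s 1 (P
  g) (g s)).
  exists (g s - P f s); apply: leb_aeS good => t /[swap] tT' /(_ tT')[tT dt].
  by have := L _ _ sT ds tT dt; lra.
by exists 0; apply: leb_aeS good => t /[swap] tT' /(_ tT') ?; case: nos; exists t.
Unshelve. all: by end_near. Qed.

End du_bois_reymond.

(** * Integrability from the Luxemburg distance *)

Section domination.
Context {R : realType}.

(** Setting [f] to 0 where the bound fails makes the bound hold everywhere, as comparison of
    integrals requires, and changes [f] only on a null set. *)
Lemma leb_ae_le_integrable (D : set (lebType R)) (f g : R -> R) : measurable D ->
  measurable_fun D f -> {ae leb R, forall t, D t -> `|f t| <= g t} ->
  (leb R).-integrable D (EFin \o g) -> (leb R).-integrable D (EFin \o f).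
Proof.
move=> mD mf fg ig.
pose f' t := if `|f t| <= g t then f t else 0.
have ff' : {ae leb R, forall t, D t -> f t = f' t}.
  by apply: leb_aeS fg => t fg Dt; rewrite /f' fg.
apply: (leb_ae_integrable mD (f := f')).
  by apply: leb_aeS ff' => t ff' Dt; rewrite ff'.
apply: (le_integrable mD _ _ ig).
  by apply/measurable_EFinP; exact: leb_ae_measurable ff' mf.
move=> t Dt /=; rewrite lee_fin /f'; case: ifPn => [fgt|_]; last by rewrite normr0.
by rewrite (le_trans fgt)// ler_norm.
Qed.

Lemma continuous_ball_bounded d (f : 'rV[R]_d -> R) (M : R) : continuous f ->
  exists2 B, 0 <= B & forall x, `|x| <= M -> f x <= B.
Proof.
move=> cf; pose A : set 'rV[R]_d := [set y | `|y| <= M].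
have [[y0 Ay0]|nA] := pselect (exists y, A y); last first.
  by exists 0 => // x xM; case: nA; exists x.
have cA : compact A.
  apply: bounded_closed_compact.
    by exists M; split => [|N MN x /= /le_trans]; [exact: num_real|apply; exact:
      ltW].
  apply: (@preimage_closed _ _ (fun y : 'rV[R]_d => `|y|) [set r | r <= M]).
    by move=> x _; exact: norm_continuous.
  exact: closed_le.
have [|c _ H] := @EVT_max_rV R d f A (ex_intro _ y0 Ay0) cA.
  exact: continuous_subspaceT.
exists (`|f c|) => // x xM; apply: le_trans (ler_norm _).
by apply: H; rewrite inE.
Qed.

Lemma leb_integrable_realD (D : set (lebType R)) (f g : R -> R) : measurable D ->
  (leb R).-integrable D (EFin \o f) -> (leb R).-integrable D (EFin \o g) ->
  (leb R).-integrable D (EFin \o (fun t => f t + g t)).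
Proof. by move=> mD; exact: integrableD. Qed.

Lemma leb_integrable_realZ (D : set (lebType R)) (c : R) (f : R -> R) :
  measurable D ->
  (leb R).-integrable D (EFin \o f) ->
  (leb R).-integrable D (EFin \o (fun t => c * f t)).
Proof. by move=> mD; exact: integrableZl. Qed.

Lemma leb_integrable_cst (T c : R) : (leb R).-integrable `[0, T] (EFin \o cst c).
Proof.
apply: measurable_bounded_integrable => //.
- exact: leb_measurable_itv.
- rewrite [ltLHS](lebesgue_measure_itv `[0, T])/=.
  by case: ifP => _; rewrite ltry.
- by exists `|c|; split; [exact: num_real|move=> N cN t _; exact: ltW].
Qed.

End domination.

Section luxemburg_distance.
Context {R : realType} {d : nat}.
Variables (T : R) (Phi : 'rV[R]_d -> R).

Lemma luxemburg_dist_lt1 (w : R -> 'rV[R]_d) :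
  (luxemburg_dist T Phi w (L_infty T) < 1)%E ->
  exists (v : R -> 'rV[R]_d) (l : R), [/\ L_infty T v, 0 < l < 1 &
    (\int[leb R]_(t in `[0%R, T]) (Phi (l^-1 *: (w t - v t)))%:E <= 1)%E].
Proof.
move=> /ereal_inf_lt[_ [v Lv <-]] /ereal_inf_lt[_ [l [l0 Il] <-]].
by rewrite lte_fin => l1; exists v, l; rewrite l0 l1.
Qed.

Lemma vmeasurableD u v : vmeasurable T u -> vmeasurable T v ->
  vmeasurable (d := d) T (fun t => u t + v t).
Proof.
move=> mu mv i; rewrite (_ : (fun _ => _) = (fun t => u t ord0 i + v t ord0 i)).
  exact: measurable_funD.
by apply/funext => t; rewrite mxE.
Qed.

Lemma vmeasurableZ (c : R -> R) v : measurable_fun (`[0, T] : set (lebType R)) c ->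
  vmeasurable T v -> vmeasurable (d := d) T (fun t => c t *: v t).
Proof.
move=> mc mv i; rewrite (_ : (fun _ => _) = (fun t => c t * v t ord0 i)).
  exact: measurable_funM.
by apply/funext => t; rewrite mxE.
Qed.

Lemma vmeasurable_cst v : vmeasurable (d := d) T (fun=> v).
Proof. by move=> i; exact: measurable_cst. Qed.

Hypothesis Phi_Ninfty : Ninfty_function Phi.
Hypothesis Phi_strict : strictly_convex Phi.

Lemma Ninfty_continuous : continuous Phi.
Proof.
by move=> x; apply: differentiable_continuous; exact: Ninfty_differentiable.
Qed.

(* [w + k] is the convex combination of [(w - v) / l] and [(v + k) / (1 - l)]. *)
Lemma integrable_Phi_dist_lt1 (w k : R -> 'rV[R]_d) (K : R) :
  vmeasurable T w -> (luxemburg_dist T Phi w (L_infty T) < 1)%E ->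
  vmeasurable T k -> (forall t, enorm (k t) <= K) ->
  (leb R).-integrable `[0, T] (EFin \o (fun t => Phi (w t + k t))).
Proof.
move=> mw /luxemburg_dist_lt1[v [l [[mv [M vM]] /andP[l0 l1] Il]]] mk kK.
have mD : @measurable _ (lebType R) (`[0, T] : set R) by exact: leb_measurable_itv.
have l1' : 0 < 1 - l by lra.
(* A ball containing (v + k) / (1 - l) at a.e. t, since |v| <= M a.e. and |k| <= K. *)
have [B B0 HB] := continuous_ball_bounded ((1 - l)^-1 * (M + K)) Ninfty_continuous.
pose A t := Phi (l^-1 *: (w t - v t)).
have mA : measurable_fun (`[0, T] : set (lebType R)) A.
  apply: (leb_measurable_comp (w := fun t => l^-1 *: (w t - v t))
    Ninfty_continuous).
  have mc c : measurable_fun (`[0, T] : set (lebType R)) (cst c : R -> R).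
    exact: measurable_cst.
  apply: (vmeasurableZ (mc l^-1)).
  rewrite (_ : (fun _ => _) = (fun t => w t + (-1) *: v t)); last first.
    by apply/funext => t; rewrite scaleN1r.
  exact: (vmeasurableD mw (vmeasurableZ (mc (-1)) mv)).
have intA : (leb R).-integrable `[0, T] (EFin \o A).
  apply/integrableP; split; first exact/measurable_EFinP.
  apply: le_lt_trans (ltry 1); apply: le_trans Il.
  rewrite le_eqVlt; apply/orP; left; apply/eqP; apply: eq_integral => t _ /=.
  by rewrite ger0_norm//; exact: Ninfty_ge0.
apply: (leb_ae_le_integrable mD (g := fun t => l * A t + (1 - l) * B)).
- exact: (leb_measurable_comp (w := fun t => w t + k t) Ninfty_continuous
  (vmeasurableD mw mk)).
- apply: leb_aeS vM => t vM Dt; rewrite ger0_norm; last exact: Ninfty_ge0.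
  have l01 : 0 <= l <= 1 by rewrite !ltW.
  have := strictly_convex_le (l^-1 *: (w t - v t)) ((1 - l)^-1 *: (v t + k t))
    Phi_strict l01.
  rewrite !scalerA !divff ?gt_eqF// !scale1r addrA subrK => /le_trans; apply.
  have li0 : 0 <= (1 - l)^-1 by rewrite invr_ge0 ltW.
  rewrite lerD2l; apply: ler_wpM2l; first exact: ltW.
  apply: HB; rewrite normrZ ger0_norm//; apply: ler_wpM2l => //.
  rewrite (le_trans (ler_normD _ _))// lerD//.
    by rewrite (le_trans (norm_le_enorm _))// vM.
  by rewrite (le_trans (norm_le_enorm _)).
- apply: leb_integrable_realD => //; last exact: leb_integrable_cst.
  exact: leb_integrable_realZ.
Qed.

End luxemburg_distance.

(** * The first variation *)

Section mean_value.
Context {R : realType} {d : nat}.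
Implicit Types (f : 'rV[R]_d -> R) (x y v : 'rV[R]_d).

Lemma is_derive_line f y v (x : R) : differentiable f (x *: v + y) ->
  is_derive x 1 (fun s : R => f (s *: v + y)) ('D_v f (x *: v + y)).
Proof.
move=> df; have := @diff_derivable _ _ _ f (x *: v + y) v df.
rewrite /derivable => dfv.
have E : (fun h : R => h^-1 *: (((fun s : R => f (s *: v + y)) \o shift x) (h *:
  1) - f (x *: v + y))) =
    (fun h : R => h^-1 *: ((f \o shift (x *: v + y)) (h *: v) - f (x *: v + y))).
  by apply/funext => h /=; rewrite addrA -scalerDl [h *: 1]mulr1.
by split; rewrite /derivable /derive E.
Qed.

Lemma differentiable_MVT f y v : (forall x, differentiable f x) ->
  exists2 c : R, 0 <= c <= 1 & f (v + y) - f y = dotmul v (grad f (c *: v + y)).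
Proof.
move=> df.
have dphi (x : R) := @is_derive_line f y v x (df _).
have [|c c01] := @MVT_segment R (fun s => f (s *: v + y))
    (fun s => 'D_v f (s *: v + y)) 0 1 ler01.
  by apply: derivable_within_continuous => x _; have [] := dphi x.
rewrite scale1r scale0r add0r subr0 mulr1 derive_dotmul// => ->.
by exists c => //; move: c01; rewrite in_itv.
Qed.

Lemma is_deriveZl (h : R -> R) v (t c : R) : is_derive t 1 h c ->
  is_derive t 1 (fun s => h s *: v) (c *: v).
Proof.
move=> [/derivable1_diffP dh hc].
have dhv : differentiable (fun s => h s *: v) t by exact: differentiableZl.
split; first exact/derivable1_diffP.
by rewrite deriveE// diffZl// -deriveE// hc.
Qed.

End mean_value.

Section lipschitz_test_lemmas.
Context {R : realType} (T : R).

(** Positive factors s give the perturbations; s = -1 reverses the variational inequality. *)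
Lemma lipschitz_testZ (s : R) (h k : R -> R) : lipschitz_test T h k ->
  lipschitz_test T (fun t => s * h t) (fun t => s * k t).
Proof.
move=> [K [hK kK mk dh h0T]]; exists (`|s| * K); split.
- by move=> x y xy; rewrite -mulrBr normrM -mulrA ler_wpM2l// hK.
- by move=> t; rewrite normrM ler_wpM2l.
- exact: measurable_funM.
- by apply: leb_aeS dh => t /[swap] tT /(_ tT) dh; exact: (is_deriveZ s dh).
- by rewrite h0T.
Qed.

End lipschitz_test_lemmas.

Section first_variation.
Context {R : realType} {d : nat}.
Variables (T : R) (Phi : 'rV[R]_d -> R) (F : R -> 'rV[R]_d -> R).
Variables (a : 'rV[R]_d -> R) (b : R -> R) (u : R -> 'rV[R]_d).
Hypothesis T_gt0 : 0 < T.
Hypothesis Phi_Ninfty : Ninfty_function Phi.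
Hypothesis Phi_strict : strictly_convex Phi.
Hypothesis F_differentiable : {ae leb R, forall t, t \in `[0, T] ->
  forall x, differentiable (F t) x}.
Hypothesis F_caratheodory : caratheodory T F.
Hypothesis gradF_caratheodory : vcaratheodory T (fun t x => grad (F t) x).
Hypothesis a_continuous : continuous a.
Hypothesis b_ge0 : {ae leb R, forall t, t \in `[0, T] -> 0 <= b t}.
Hypothesis b_integrable : (leb R).-integrable `[0, T] (fun t => (b t)%:E).
Hypothesis F_bound : {ae leb R, forall t, t \in `[0, T] ->
  forall x, `|F t x| + enorm (grad (F t) x) <= a x * b t}.
Hypothesis u_minimum : is_minimum_on T Phi F (periodic_W1L_Phi T Phi) u.
Hypothesis u'_dist : (luxemburg_dist T Phi (derive1 u) (L_infty T) < 1)%E.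

Let mD : @measurable _ (lebType R) (`[0, T] : set R).
Proof. exact: leb_measurable_itv. Qed.

Let e (i : 'I_d) : 'rV[R]_d := delta_mx ord0 i.

Let enormZe c i : enorm (c *: e i) <= `|c|.
Proof.
have := enormD_delta (0 : 'rV[R]_d) c i; rewrite add0r => /le_trans; apply.
rewrite gerDr le_eqVlt; apply/orP; left; apply/eqP.
by rewrite /enorm /dotmul big1 ?sqrtr0// => j _; rewrite mxE mul0r.
Qed.

Let acu : absolutely_continuous T u.
Proof. by have [[[]]] := u_minimum. Qed.

Let mu' : vmeasurable T (derive1 u).
Proof. by have [[[_ _ []]]] := u_minimum. Qed.

(** Continuous curves stay in a ball on [0, T], and there [a] is bounded; this leaves an integrable
    bound independent of x. *)
Let ball_bound (M : R) : exists2 B, 0 <= B & {ae leb R, forall t, t \in `[0, T] ->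
  forall x, `|x| <= M -> `|F t x| <= B * b t /\ enorm (grad (F t) x) <= B * b t}.
Proof.
have [B B0 HB] := continuous_ball_bounded M a_continuous.
exists B => //; apply: leb_aeS2 b_ge0 F_bound => t b0 Fb Dt x xM.
have := Fb Dt x.
have := ler_wpM2r (b0 Dt) (HB _ xM).
have := normr_ge0 (F t x); have := enorm_ge0 (grad (F t) x).
by split; lra.
Qed.

Lemma integrable_F v : absolutely_continuous T v ->
  (leb R).-integrable `[0, T] (EFin \o (fun t => F t (v t))).
Proof.
move=> /absolutely_continuous_within cv.
have [M HM] := within_continuous_bounded (ltW T_gt0) cv.
have [B B0 HB] := ball_bound M.
apply: (leb_ae_le_integrable mD (g := fun t => B * b t)).
- apply: leb_measurable_superposition; [exact: F_caratheodory.1|exact: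
  F_caratheodory.2|].
  exact: within_continuous_vmeasurable.
- by apply: leb_aeS HB => t HB Dt; have [] := HB Dt (v t) (HM t Dt).
- exact: leb_integrable_realZ.
Qed.

Lemma integrable_gradF i :
  (leb R).-integrable `[0, T] (EFin \o (fun t => grad (F t) (u t) ord0 i)).
Proof.
have cu := absolutely_continuous_within acu.
have [M HM] := within_continuous_bounded (ltW T_gt0) cu.
have [B B0 HB] := ball_bound M.
apply: (leb_ae_le_integrable mD (g := fun t => B * b t)).
- apply: (@leb_measurable_superposition _ _ _ (fun t x => grad (F t) x ord0 i)).
  + by move=> x; exact: gradF_caratheodory.1.
  + apply: leb_aeS gradF_caratheodory.2 => t cg Dt x.
    apply: (@continuous_comp _ _ _ _ (fun v : 'rV[R]_d => v ord0 i)); first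
      exact: cg.
    exact: coord_continuous.
  + exact: within_continuous_vmeasurable.
- apply: leb_aeS HB => t HB Dt; have [_] := HB Dt (u t) (HM t Dt).
  by apply: le_trans; exact: coord_le_enorm.
- exact: leb_integrable_realZ.
Qed.

Lemma integrable_Phi i (c : R -> R) (K : R) :
  measurable_fun (`[0, T] : set (lebType R)) c -> (forall t, `|c t| <= K) ->
  (leb R).-integrable `[0, T] (EFin \o (fun t => Phi (derive1 u t + c t *: e i))).
Proof.
move=> mc cK; apply: (@integrable_Phi_dist_lt1 _ _ _ _ Phi_Ninfty Phi_strict _
  (fun t => c t *: e i) K mu' u'_dist).
  by apply: vmeasurableZ => //; exact: vmeasurable_cst.
by move=> t; exact: le_trans (enormZe _ _) (cK t).
Qed.

Let integrable_Phi_cst i (c : R) :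
  (leb R).-integrable `[0, T] (EFin \o (fun t => Phi (derive1 u t + c *: e i))).
Proof.
by apply: (@integrable_Phi i (cst c) `|c|) => //; exact: measurable_cst.
Qed.

Let integrable_Phi0 : (leb R).-integrable `[0, T] (EFin \o (fun t => Phi (derive1
  u t))).
Proof.
have := @integrable_Phi_dist_lt1 _ _ _ _ Phi_Ninfty Phi_strict _ (fun=> 0) 0 mu'
  u'_dist (@vmeasurable_cst _ _ T 0).
have -> : (EFin \o (fun t => Phi (derive1 u t + 0))) = (EFin \o (fun t => Phi
  (derive1 u t))).
  by apply/funext => t /=; rewrite addr0.
by apply=> t; rewrite /enorm /dotmul big1 ?sqrtr0// => j _; rewrite mxE mul0r.
Qed.

Let dPhi x : differentiable Phi x.
Proof. exact: Ninfty_differentiable. Qed.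

Let cPhi : continuous Phi.
Proof. exact: Ninfty_continuous. Qed.

(** The tangent inequality at [u'] in the directions e_i and - e_i, with [Phi >= 0], bounds |d_i Phi
    (u')| by Phi (u' + e_i) + Phi (u' - e_i). Measurability comes from difference quotients. *)
Lemma integrable_gradPhi i :
  (leb R).-integrable `[0, T] (EFin \o (fun t => grad Phi (derive1 u t) ord0 i)).
Proof.
apply: (leb_ae_le_integrable mD (g := fun t =>
  Phi (derive1 u t + 1 *: e i) + Phi (derive1 u t + (-1) *: e i))).
- apply: (@leb_ae_cvg_measurable _ _ (fun n t =>
    n.+1%:R * (Phi (n.+1%:R^-1 *: e i + derive1 u t) - Phi (derive1 u t)))).
    move=> n; apply: measurable_funM; first exact: measurable_cst.
    apply: measurable_funB; last exact: leb_measurable_comp cPhi mu'.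
    exact: leb_measurable_comp cPhi (vmeasurableD (@vmeasurable_cst _ _ T _) mu').
  apply: aeW => t _; rewrite mxE.
  by apply: (@derivable_cvg_seq _ _ _ Phi); exact: diff_derivable.
- apply: aeW => t _.
  have H := grad_tilted_minimum Phi_strict (dPhi (derive1 u t)) erefl.
  have := H (derive1 u t + 1 *: e i); have := H (derive1 u t + (-1) *: e i).
  rewrite !dotmulDl !dotmulZl !dotmul_delta.
  have := Ninfty_ge0 Phi_Ninfty (derive1 u t).
  have := Ninfty_ge0 Phi_Ninfty (derive1 u t + 1 *: e i).
  have := Ninfty_ge0 Phi_Ninfty (derive1 u t + (-1) *: e i).
  by rewrite ler_norml => ? ? ? ? ?; apply/andP; split; lra.
- exact: (leb_integrable_realD mD (integrable_Phi_cst i 1) (integrable_Phi_cst i (-1))).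
Qed.

Section variation.
Variables (i : 'I_d) (h k : R -> R).
Hypothesis hk : lipschitz_test T h k.

Let v (s : R) t := u t + (s * h t) *: e i.

Let acv s : absolutely_continuous T (v s).
Proof.
have [K [hK _ _ _ _]] := lipschitz_testZ s hk.
exact: absolutely_continuousD_delta hK.
Qed.

Let ae_interior (P : R -> Prop) :
  {ae leb R, forall t, t \in `]0, T[ -> P t} ->
  {ae leb R, forall t, t \in `[0, T] -> P t}.
Proof.
apply: leb_aeS3 (leb_ae_neq 0) (leb_ae_neq T) => t t0 tT Pt.
rewrite in_itv/= => /andP[t0' tT']; apply: Pt.
by rewrite in_itv/= !lt_neqAle eq_sym t0 tT t0'.
Qed.

Let derive1_v s : {ae leb R, forall t, t \in `]0, T[ ->
  derivable (v s) t 1 /\ derive1 (v s) t = derive1 u t + (s * k t) *: e i}.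
Proof.
have [[[_ du _] _] _] := u_minimum.
have [K [_ _ _ dh _]] := lipschitz_testZ s hk.
apply: leb_aeS2 du dh => t du dh tT.
have dv : is_derive t 1 (v s) ('D_1 u t + (s * k t) *: e i).
  apply: is_deriveD; first exact/derivableP/du.
  exact/is_deriveZl/dh.
by rewrite !derive1E derive_val; split => //; exact: ex_derive.
Qed.

(** The integrand of the action along [v s], with [derive1 (v s)] replaced by the explicit function
    it equals a.e., so that the dependence on s is visible at every t. *)
Let G s t := Phi (derive1 u t + (s * k t) *: e i) + F t (v s t).

Let intPhi s :
  (leb R).-integrable `[0, T] (EFin \o (fun t => Phi (derive1 u t + (s * k t) *:
    e i))).
Proof.
have [K [_ kK mk _ _]] := lipschitz_testZ s hk.
exact: integrable_Phi kK.
Qed.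

Let intG s : (leb R).-integrable `[0, T] (EFin \o G s).
Proof. by apply: leb_integrable_realD => //; exact: integrable_F. Qed.

Let W1L_v s : periodic_W1L_Phi T Phi (v s).
Proof.
have [[[_ _ [mu'_ _]] uT] _] := u_minimum.
have d1v := ae_interior (derive1_v s).
have eqPhi : {ae leb R, forall t, t \in `[0, T] ->
    derive1 u t + (s * k t) *: e i = derive1 (v s) t}.
  by apply: leb_aeS d1v => t /[swap] Dt /(_ Dt)[].
split; last by rewrite /v uT; have [_ [_ _ _ _ ->]] := hk.
split; first exact: acv.
  by apply: leb_aeS (derive1_v s) => t /[swap] tT /(_ tT)[].
split.
  move=> j; apply: (@leb_ae_measurable _ _ (fun t => (derive1 u t + (s * k t) *:
    e i) ord0 j)).
    by apply: leb_aeS eqPhi => t /[swap] Dt /(_ Dt) ->.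
  have [K [_ _ mk _ _]] := lipschitz_testZ s hk.
  exact: (vmeasurableD mu' (vmeasurableZ mk (@vmeasurable_cst _ _ T (e i)))).
(* The distance hypothesis makes Phi of the perturbed derivative integrable without rescaling. *)
exists 1 => //.
have intv : (leb R).-integrable `[0, T] (EFin \o (fun t => Phi (1 *: derive1 (v
  s) t))).
  apply: (leb_ae_integrable mD _ (intPhi s)).
  by apply: leb_aeS eqPhi => t /[swap] Dt /(_ Dt) ->; rewrite scale1r.
exact: (integrable_lty mD intv).
Qed.

Let action_v s : action T Phi F (v s) = (\int[leb R]_(t in `[0, T]) G s t)%:E.
Proof.
rewrite /Rintegral fineK; last exact: (integrable_fin_num mD (intG s)).
have mG : measurable_fun (`[0, T] : set (lebType R)) (G s).
  by have /integrableP[/measurable_EFinP] := intG s.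
have eqG : {ae leb R, forall t, t \in `[0, T] ->
    G s t = Phi (derive1 (v s) t) + F t (v s t)}.
  apply: leb_aeS (ae_interior (derive1_v s)) => t /[swap] Dt /(_ Dt)[_ E].
  by rewrite /G -E.
apply/esym/ae_eq_integral; first exact: mD.
- exact/measurable_EFinP.
- exact/measurable_EFinP/(leb_ae_measurable eqG mG).
- by apply: leb_aeS eqG => t /[swap] Dt /(_ Dt) ->.
Qed.

Let D n t := n.+1%:R * (G n.+1%:R^-1 t - G 0 t).

Let intD n : (leb R).-integrable `[0, T] (EFin \o D n).
Proof.
apply: leb_integrable_realZ => //.
exact: (integrableB mD (intG _) (intG 0)).
Qed.

Let int_D_ge0 n : 0 <= \int[leb R]_(t in `[0, T]) D n t.
Proof.
have v0 : v 0 = u by apply/funext => t; rewrite /v mul0r scale0r addr0.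
have := u_minimum.2 _ (W1L_v n.+1%:R^-1).
rewrite -v0 !action_v lee_fin => le.
have intB : (leb R).-integrable `[0, T] (EFin \o (fun t => G n.+1%:R^-1 t - G 0 t)).
  exact: (integrableB mD (intG _) (intG 0)).
rewrite /D (RintegralZl _ mD intB) (RintegralB mD (intG _) (intG 0)).
by rewrite mulr_ge0// subr_ge0.
Qed.

Let cvg_D : {ae leb R, forall t, t \in `[0, T] -> D n t @[n --> \oo] -->
  grad Phi (derive1 u t) ord0 i * k t + grad (F t) (u t) ord0 i * h t}.
Proof.
apply: leb_aeS F_differentiable => t /[swap] Dt /(_ Dt) dF.
have cP : n.+1%:R * (Phi (derive1 u t + (n.+1%:R^-1 * k t) *: e i) - Phi (derive1
  u t))
    @[n --> \oo] --> grad Phi (derive1 u t) ord0 i * k t.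
  have := @derivable_cvg_seq _ _ _ Phi (derive1 u t) (k t *: e i) (diff_derivable
    (dPhi _)).
  have -> : 'D_(k t *: e i) Phi (derive1 u t) = grad Phi (derive1 u t) ord0 i * k t.
    by rewrite derive_dotmul// dotmulZl dotmul_delta mulrC.
  apply: cvg_trans; apply: near_eq_cvg; apply: nearW => n.
  by rewrite scalerA [_ + derive1 u t]addrC.
have cF : n.+1%:R * (F t (v n.+1%:R^-1 t) - F t (u t))
    @[n --> \oo] --> grad (F t) (u t) ord0 i * h t.
  have := @derivable_cvg_seq _ _ _ (F t) (u t) (h t *: e i) (diff_derivable (dF _)).
  have -> : 'D_(h t *: e i) (F t) (u t) = grad (F t) (u t) ord0 i * h t.
    by rewrite derive_dotmul// dotmulZl dotmul_delta mulrC.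
  apply: cvg_trans; apply: near_eq_cvg; apply: nearW => n.
  by rewrite scalerA [_ + u t]addrC.
have cPF : n.+1%:R * (Phi (derive1 u t + (n.+1%:R^-1 * k t) *: e i) - Phi
  (derive1 u t)) +
    n.+1%:R * (F t (v n.+1%:R^-1 t) - F t (u t)) @[n --> \oo] -->
    grad Phi (derive1 u t) ord0 i * k t + grad (F t) (u t) ord0 i * h t.
  exact: cvgD cP cF.
apply: cvg_trans cPF; apply: near_eq_cvg; apply: nearW => n /=.
by rewrite /D /G /v !mul0r !scale0r !addr0; ring.
Qed.

Let dominated_D : exists2 W : R -> R, (leb R).-integrable `[0, T] (EFin \o W) &
  {ae leb R, forall t, t \in `[0, T] -> forall n, `|D n t| <= W t}.
Proof.
have [K [hK kK _ _ _]] := hk.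
have K0 : 0 <= K by exact: le_trans (kK 0).
(* A bound of |h| on [0, T] from its Lipschitz constant; with [M] bounding u, all perturbed points
   stay in the ball of radius H + M. *)
pose H := `|h 0| + K * T.
have H0 : 0 <= H by rewrite addr_ge0// mulr_ge0// ltW.
have hH t : t \in `[0, T] -> `|h t| <= H.
  rewrite in_itv/= => /andP[t0 tT].
  rewrite -[h t](subrK (h 0)) addrC (le_trans (ler_normD _ _))// lerD2l.
  by rewrite (le_trans (hK _ _ t0))// subr0 ler_wpM2l.
have [M HM] := within_continuous_bounded (ltW T_gt0)
  (absolutely_continuous_within acu).
have [B B0 HB] := ball_bound (H + M).
(* The [Phi] terms come from the two convex quotient bounds, the last term from the mean value
   theorem for [F]: |h| <= H and |d_i F| <= B b on the ball. *)
exists (fun t => (Phi (derive1 u t + (1 * k t) *: e i) +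
  Phi (derive1 u t + (-1 * k t) *: e i) + Phi (derive1 u t)) + (H * B) * b t).
  apply: (leb_integrable_realD mD); last exact: leb_integrable_realZ.
  apply: (leb_integrable_realD mD _ integrable_Phi0).
  exact: (leb_integrable_realD mD (intPhi 1) (intPhi (-1))).
apply: leb_aeS2 F_differentiable HB => t dF HB Dt n.
have n0 : 0 < n.+1%:R :> R by rewrite ltr0n.
have nV0 : 0 < n.+1%:R^-1 :> R by rewrite invr_gt0.
have n01 : 0 <= (n.+1%:R^-1 : R) <= 1 by rewrite ltW//= invf_le1// ler1n.
rewrite /D /G /v !mul0r !scale0r !addr0.
rewrite (_ : _ * _ = n.+1%:R * (Phi (derive1 u t + (n.+1%:R^-1 * k t) *: e i) -
  Phi (derive1 u t)) +
  n.+1%:R * (F t (u t + (n.+1%:R^-1 * h t) *: e i) - F t (u t))); last by ring.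
rewrite (le_trans (ler_normD _ _))// lerD//.
  have := strictly_convex_right_quotient (derive1 u t) (k t *: e i) Phi_strict n01.
  have := strictly_convex_left_quotient (derive1 u t) (k t *: e i) Phi_strict n01.
  rewrite scalerA => /(ler_wpM2l (ltW n0)) + /(ler_wpM2l (ltW n0)).
  rewrite !mulrA divff ?gt_eqF// !mul1r mulN1r scaleNr.
  have := Ninfty_ge0 Phi_Ninfty (derive1 u t).
  have := Ninfty_ge0 Phi_Ninfty (derive1 u t + k t *: e i).
  have := Ninfty_ge0 Phi_Ninfty (derive1 u t - k t *: e i).
  by rewrite ler_norml; move: (_ * _) => z ? ? ? ? ?; apply/andP; split; lra.
have [c /andP[c0 c1]] := differentiable_MVT (u t) ((n.+1%:R^-1 * h t) *: e i) (dF
  Dt).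
rewrite [u t + _]addrC => ->; rewrite dotmulZl dotmul_delta mulrA mulrA divff
  ?gt_eqF// mul1r normrM.
rewrite -mulrA; apply: ler_pM => //; first exact: hH.
apply: le_trans (coord_le_enorm _ _) _.
apply: (HB Dt _ _).2.
rewrite (le_trans (ler_normD _ _))// lerD//; last exact: HM.
rewrite (le_trans (norm_le_enorm _))// scalerA (le_trans (enormZe _ _))//.
rewrite mulrA normrM; apply: le_trans (hH t Dt); apply: ler_piMl => //.
by case/andP: n01 => ? ?; rewrite ger0_norm ?mulr_ge0// mulr_ile1.
Qed.

(** Minimality makes each quotient integral nonnegative, and dominated convergence passes this to
    the limit. Integrability is recorded too, since reversing the sign relies on linearity of the
    integral. *)
Lemma first_variation_ge0 :
  (leb R).-integrable `[0, T] (EFin \o (fun t =>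
    grad Phi (derive1 u t) ord0 i * k t + grad (F t) (u t) ord0 i * h t)) /\
  0 <= \int[leb R]_(t in `[0, T])
    (grad Phi (derive1 u t) ord0 i * k t + grad (F t) (u t) ord0 i * h t).
Proof.
have [W intW DW] := dominated_D.
have [] := @dominated_convergence _ _ _ (leb R) `[0, T] mD (fun n t => (D n t)%:E)
  (fun t => (grad Phi (derive1 u t) ord0 i * k t + grad (F t) (u t) ord0 i * h
    t)%:E)
  (EFin \o W).
- by move=> n; have /integrableP[] := intD n.
- apply/measurable_EFinP; apply: leb_ae_cvg_measurable cvg_D => n.
  by have /integrableP[/measurable_EFinP] := intD n.
- apply: leb_aeS cvg_D => t /[swap] Dt /(_ Dt) cD.
  by apply: cvg_EFin => //; exact: nearW.
- exact: intW.
- by apply: leb_aeS DW => t DW n Dt; rewrite lee_fin DW.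
move=> intl _ cI; split; first exact: intl.
have cfine : \int[leb R]_(t in `[0, T]) D n t @[n --> \oo] -->
    \int[leb R]_(t in `[0, T])
      (grad Phi (derive1 u t) ord0 i * k t + grad (F t) (u t) ord0 i * h t).
  by apply: fine_cvg; rewrite fineK; [exact: cI|exact: (integrable_fin_num mD
    intl)].
rewrite -(cvg_lim _ cfine)//; apply: limr_ge; first exact: (cvgP _ cfine).
by apply: nearW => n; exact: int_D_ge0.
Qed.

End variation.

Lemma weak_euler_lagrange i (h k : R -> R) : lipschitz_test T h k ->
  \int[leb R]_(t in `[0, T])
    (grad Phi (derive1 u t) ord0 i * k t + grad (F t) (u t) ord0 i * h t) = 0.
Proof.
move=> hk; have [intl ge0] := first_variation_ge0 i hk.
have [_] := first_variation_ge0 i (lipschitz_testZ (-1) hk).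
rewrite (_ : Rintegral _ _ _ = -1 * \int[leb R]_(t in `[0, T])
    (grad Phi (derive1 u t) ord0 i * k t + grad (F t) (u t) ord0 i * h t)).
  by rewrite mulN1r oppr_ge0 => le0; apply/le_anti; rewrite ge0 le0.
rewrite -(RintegralZl _ mD intl); apply: eq_Rintegral => t _.
by rewrite mulrDr !(mulrCA _ (-1)).
Qed.

End first_variation.

(** * Construction of the periodic solution *)

Section assembly.
Context {R : realType} {d : nat}.

Lemma is_derive_row (p : R -> 'rV[R]_d) (t : R) (c : 'rV[R]_d) :
  (forall i, is_derive t 1 (fun s => p s ord0 i) (c ord0 i)) ->
  is_derive t 1 p c.
Proof.
move=> dp.
have pt : derivable p t 1.
  by apply/derivable_mxP => i j; rewrite ord1; exact: ex_derive.
split=> //; rewrite derive_mx//; apply/rowP => j; rewrite mxE.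
by have -> := derive_val (is_derive := dp j).
Qed.

Lemma leb_ae_forall_ord (P : 'I_d -> R -> Prop) :
  (forall i, {ae leb R, forall t, P i t}) ->
  {ae leb R, forall t, forall i, P i t}.
Proof.
move=> HP.
exact: (@filter_forall _ _ _ (almost_everywhere (leb R))
  (ae_filter_ringOfSetsType (leb R)) HP).
Qed.

(** On a singleton every function is measurable, so nothing has to be known about [f]. *)
Lemma leb_Rintegral_itv0 (f : R -> R) : \int[leb R]_(t in `[0, 0]) f t = 0.
Proof.
rewrite /Rintegral; have [mf|nf] := pselect (measurable_fun (`[0, 0] : set
  (lebType R)) (EFin \o f)).
  rewrite null_set_integral//.
    exact: leb_measurable_itv.
  by rewrite [LHS](lebesgue_measure_itv `[0, 0])/= ltxx.
case: nf; apply/measurable_EFinP => /= mD B mB.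
rewrite set_itv1.
have [B0|B0] := pselect (B (f 0)).
  rewrite (_ : _ `&` _ = [set 0]); first by rewrite -set_itv1.
  by apply/seteqP; split => [x []//|x ->]; split.
rewrite (_ : _ `&` _ = set0); first exact: measurable0.
by apply/seteqP; split => [x [/= ->]|].
Qed.

End assembly.

Theorem theorem4p1 (R : realType) (d : nat) (T : R)
  (Phi : 'rV[R]_d -> R) (F : R -> 'rV[R]_d -> R)
  (a : 'rV[R]_d -> R) (b : R -> R)
  (Phi0 : 'rV[R]_d -> R) (delta : R -> R) (u : R -> 'rV[R]_d)
  (T_gt0 : 0 < T)
  (Phi_Ninfty : Ninfty_function Phi)
  (Phi_strict : strictly_convex Phi)
  (F_differentiable : {ae leb R, forall t, t \in `[0, T] ->
     forall x, differentiable (F t) x})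
  (F_caratheodory : caratheodory T F)
  (gradF_caratheodory : vcaratheodory T (fun t x => grad (F t) x))
  (a_continuous : continuous a)
  (a_ge0 : forall x, 0 <= a x)
  (b_ge0 : {ae leb R, forall t, t \in `[0, T] -> 0 <= b t})
  (b_integrable : (leb R).-integrable `[0, T] (fun t => (b t)%:E))
  (F_bound : {ae leb R, forall t, t \in `[0, T] ->
     forall x, `|F t x| + enorm (grad (F t) x) <= a x * b t})
  (Phi0_Ninfty : Ninfty_function Phi0)
  (Phi0_Phi : forall k : R, 0 < k -> exists2 C : R, 0 < C &
     forall x, Phi0 x <= C + Phi (k *: x))
  (delta_integrable : (leb R).-integrable `[0, T] (fun t => (delta t)%:E))
  (delta_ge1 : {ae leb R, forall t, t \in `[0, T] -> 1 <= delta t})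
  (gradF_bound : {ae leb R, forall t, t \in `[0, T] -> forall x,
     (complementary Phi ((delta t)^-1 *: grad (F t) x) <= (Phi0 x + 1)%:E)%E})
  (F_coercive : (\int[leb R]_(t in `[0, T]) F t x) / Phi0 (2 *: x)
     @[x --> enorm_pinfty] --> +oo_R)
  (u_minimum : is_minimum_on T Phi F (periodic_W1L_Phi T Phi) u)
  (u'_dist : (luxemburg_dist T Phi (derive1 u) (L_infty T) < 1)%E) :
  periodic_solution T Phi F u.
Proof.
have cPhi := Ninfty_continuous Phi_Ninfty.
have dPhi := Ninfty_differentiable Phi_Ninfty.
pose f i t := grad (F t) (u t) ord0 i.
have intf i : (leb R).-integrable `[0, T] (EFin \o f i).
  exact: integrable_gradF F_bound u_minimum i.
have dbr i := du_bois_reymond (intf i)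
  (integrable_gradPhi Phi_Ninfty Phi_strict u_minimum u'_dist i)
  (weak_euler_lagrange T_gt0 Phi_Ninfty Phi_strict F_differentiable
     F_caratheodory a_continuous b_ge0 b_integrable F_bound u_minimum u'_dist i).
have [c Hc] := choice (fun i => (dbr i).2).
pose p t := \row_i c i + \row_i \int[leb R]_(s in `[0, t]) f i s.
have pE t i : p t ord0 i = c i + \int[leb R]_(s in `[0, t]) f i s.
  by rewrite !mxE.
have acp : absolutely_continuous T p by exact: leb_integral_absolutely_continuous.
(* [W] is the inverse of the gradient of [Phi]. *)
have [W HW] := choice (fun z => tilted_minimum_exists z cPhi
  (Ninfty_at0 Phi_Ninfty) (Ninfty_superlinear Phi_Ninfty)).
have cW := tilted_minimum_continuous cPhi Phi_strict HW.
(* The increment of [p] over [0, T] is the integral of the gradient of [F] along u, which the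
   constant tests show to vanish. *)
have p0T : p 0 = p T.
  apply/rowP => i; rewrite !pE leb_Rintegral_itv0.
  by have [->] := dbr i.
have gradu'p : {ae leb R, forall t, t \in `[0, T] -> grad Phi (derive1 u t) = p t}.
  apply: leb_aeS (leb_ae_forall_ord Hc) => t Ht Dt.
  by apply/rowP => i; rewrite pE; exact: Ht.
exists p, (W \o p); split => //.
- apply: leb_aeS (leb_ae_forall_ord (fun i => leb_FTC1 (intf i))) => t Ht tT.
  apply: is_derive_row => i.
  rewrite (_ : (fun s => p s ord0 i) = cst (c i) + (fun s => \int[leb R]_(r in
    `[0, s]) f i r)).
    by apply: is_derive_eq; [apply: is_deriveD; exact: Ht|rewrite add0r].
  by apply/funext => s; rewrite pE.
- split.
  + have cp := absolutely_continuous_within acp.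
    move=> t; exact: (@continuous_comp (subspace `[0, T]) _ _ p W t (cp t) (cW _)).
  (* Both [derive1 u t] and [W (p t)] minimise [Phi] tilted by [p t], and strict convexity allows
     one minimiser. *)
  + apply: leb_aeS gradu'p => t /[swap] Dt /(_ Dt) gp.
    exact: tilted_minimum_uniq Phi_strict (grad_tilted_minimum Phi_strict (dPhi
      _) gp) (HW _).
  + by move=> t _; exact: tilted_minimum_grad (dPhi _) (HW _).
  + by rewrite u_minimum.1.2 subrr.
  + by rewrite /= p0T subrr.
Qed.
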